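(* Let $A\ge 0$ be a self-adjoint operator in a Hilbert space $\mathcal H$, let $J_A$ be a self-adjoint involution on $\mathcal H$ commuting with $A$, and let $$\mathfrak a[x,y]:=\langle A^{1/2}x,J_AA^{1/2}y\rangle,\qquad \mathrm{Dom}[\mathfrak a]=\mathrm{Dom}(A^{1/2}).$$ Suppose that $\mathfrak v$ is a symmetric sesquilinear form and $\beta$ is a finite constant with $$\mathrm{Dom}[\mathfrak v]\supseteq\mathrm{Dom}[\mathfrak a],\qquad \mathfrak v[J_Ax,y]=-\mathfrak v[x,J_Ay],\qquad |\mathfrak v[x]|\le\beta\,\|(A+I)^{1/2}x\|^2,\qquad x,y\in\mathrm{Dom}[\mathfrak a].$$ Let $\mathfrak b:=\mathfrak a+\mathfrak v$ on $\mathrm{Dom}[\mathfrak b]:=\mathrm{Dom}[\mathfrak a]$. Then $\mathfrak b$ is associated with a unique self-adjoint operator $B$, i.e. there is a unique self-adjoint operator $B$ with $\mathrm{Dom}(B)\subseteq\mathrm{Dom}[\mathfrak b]$ and $\mathfrak b[x,y]=\langle x,By\rangle$ for all $x\in\mathrm{Dom}[\mathfrak b]$, $y\in\mathrm{Dom}(B)$. If additionally $\mathrm{Dom}(|B|^{1/2})=\mathrm{Dom}[\mathfrak b]$ holds, then $\mathfrak b$ is represented by $B$, i.e. $$\mathfrak b[x,y]=\langle |B|^{1/2}x,\mathrm{sign}(B)|B|^{1/2}y\rangle\quad\text{for all }x,y\in\mathrm{Dom}[\mathfrak b].$$ The kernel of $B$ can explicitly be written as $$\mathrm{Ker}(B)=(\mathrm{Ker}(A_+)\cap\mathcal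 L_+)\oplus(\mathrm{Ker}(A_-)\cap\mathcal L_-),$$ where $A=A_+\oplus A_-$ is the decomposition induced by $J_A$ and $$\mathcal L_\pm:=\{x_\pm\in\mathrm{Dom}(A_\pm^{1/2}) : \mathfrak v[x_+\oplus 0,0\oplus x_-]=0\ \text{ for all }x_\mp\in\mathrm{Dom}(A_\mp^{1/2})\}.$$
   Context: A self-adjoint involution is a bounded self-adjoint operator $J$ with $J^2=I$; it commutes with a self-adjoint operator $A$ if $J\,\mathrm{Dom}(A)\subseteq\mathrm{Dom}(A)$ and $JAx=AJx$ for all $x\in\mathrm{Dom}(A)$. For a form, $\mathfrak v[x]:=\mathfrak v[x,x]$. The involution $J_A$ induces the orthogonal decomposition $\mathcal H=\mathcal H_+\oplus\mathcal H_-$ with $\mathcal H_\pm:=\mathrm{Ran}(I\pm J_A)$, which reduces $A$; $A_\pm$ denotes the self-adjoint restriction of $A$ to $\mathcal H_\pm$ with domain $\mathrm{Dom}(A)\cap\mathcal H_\pm$, and $x_+\oplus x_-$ denotes the vector with components $x_\pm\in\mathcal H_\pm$. $|B|^{1/2}$ and $\mathrm{sign}(B)$ are defined by functional calculus, with $\mathrm{sign}(0):=0$. *)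

(* Defs.v *)
(* MathComp-Analysis, with the complex numbers R[i] of real-closed over an
   arbitrary realType R. *)
From HB Require Import structures.
From mathcomp Require Import all_boot all_order all_algebra.
From mathcomp Require Import all_classical all_reals all_analysis.
From mathcomp Require Import sesquilinear complex.

Set Implicit Arguments.
Unset Strict Implicit.
Unset Printing Implicit Defensive.

Import Order.TTheory GRing.Theory Num.Theory.
Import numFieldNormedType.Exports.

Local Open Scope classical_set_scope.
Local Open Scope ring_scope.


(* A complex Hilbert space is a [completeNormedModType R[i]] with an inner
   product [dot : {dot H for Num.conj}] inducing its norm.  As in sesquilinear.v,
   [dot], and every form below, is linear in the first argument and conjugate
   linear in the second one. *)
Definition induces_norm (R : realType) (H : normedModType R[i])
    (dot : {dot H for Num.conj}) : Prop :=
  forall x : H, dot x x = `|x| ^+ 2.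

Section Operators.
Context {R : realType} {H : completeNormedModType R[i]}.
Implicit Types (D K U V : set H).

Definition linear_subspace D : Prop :=
  D 0 /\ forall (c : R[i]) x y, D x -> D y -> D (c *: x + y).

(* The values of [app] outside [dom] are irrelevant: two operators are equal
   when their graphs are. *)
Record operator : Type := Operator { dom : set H ; app :> H -> H }.

Implicit Types (S T : operator).

Definition graph T : set (H * H) := [set p | dom T p.1 /\ T p.1 = p.2].

Definition linear_op T : Prop :=
  linear_subspace (dom T) /\
  forall (c : R[i]) x y, dom T x -> dom T y -> T (c *: x + y) = c *: T x + T y.

Definition op_ker T : set H := [set x | dom T x /\ T x = 0].

Definition op_comp S T : operator :=
  Operator [set x | dom T x /\ dom S (T x)] (fun x => S (T x)).

Definition op_addI T : operator := Operator (dom T) (fun x => T x + x).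

Definition op_restrict T K : operator := Operator (dom T `&` K) T.

(* Values outside [fdom] are irrelevant. *)
Record dform : Type := Form { fdom : set H ; fval :> H -> H -> R[i] }.

Implicit Types (a b v : dform).

Definition sesquilinear_dform v : Prop :=
  [/\ linear_subspace (fdom v),
      (forall c x y z, fdom v x -> fdom v y -> fdom v z ->
         v (c *: x + y) z = c * v x z + v y z) &
      (forall c x y z, fdom v x -> fdom v y -> fdom v z ->
         v z (c *: x + y) = c^* * v z x + v z y)].

Definition symmetric_dform v : Prop :=
  forall x y, fdom v x -> fdom v y -> v x y = (v y x)^*.

(* The perturbed form [a + v], on the domain of [a]. *)
Definition perturbed a v : dform := Form (fdom a) (fun x y => a x y + v x y).

(* The sum of two subspaces; it is the orthogonal sum when they lie in
   [ran_plus J] and [ran_minus J] respectively. *)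
Definition osum U V : set H := [set x + y | x in U & y in V].

Definition ran_plus (J : H -> H) : set H := range (fun x => x + J x).
Definition ran_minus (J : H -> H) : set H := range (fun x => x - J x).

Definition commutes (J : H -> H) T : Prop :=
  forall x, dom T x -> dom T (J x) /\ J (T x) = T (J x).

Section InnerProduct.
Variable dot : {dot H for Num.conj}.

(* Operators in a closed subspace [K], regarded as a Hilbert space of its own:
   the adjoint, the density of the domain, etc. are those in [K]. *)
Definition adjoint_graph K T : set (H * H) :=
  [set p | [/\ K p.1, K p.2 & forall x, dom T x -> dot (T x) p.1 = dot x p.2]].

Definition selfadjoint_in K T : Prop :=
  [/\ linear_op T, dom T `<=` K, K `<=` closure (dom T) &
      adjoint_graph K T = graph T].

Definition selfadjoint T : Prop := selfadjoint_in setT T.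

Definition nonneg_op T : Prop := forall x, dom T x -> 0 <= dot (T x) x.

(* [S] is the square root of the nonnegative self-adjoint operator [T] in [K],
   i.e. the unique nonnegative self-adjoint operator in [K] with [S S = T],
   the domains being equal. *)
Definition is_sqrt_in K T S : Prop :=
  [/\ selfadjoint_in K S, nonneg_op S & graph (op_comp S S) = graph T].

Definition is_sqrt T S : Prop := is_sqrt_in setT T S.

Definition selfadjoint_involution (J : {linear H -> H}) : Prop :=
  [/\ continuous J, (forall x y, dot (J x) y = dot x (J y)) &
      (forall x, J (J x) = x)].

(* The form <A^{1/2} x, J A^{1/2} y> on Dom(A^{1/2}), where [S] is A^{1/2}. *)
Definition indefinite_form (J : H -> H) S : dform :=
  Form (dom S) (fun x y => dot (S x) (J (S y))).

Definition associated b T : Prop :=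
  dom T `<=` fdom b /\
  forall x y, fdom b x -> dom T y -> b x y = dot x (T y).

(* Projection-valued measures on the Borel sets of R.  The values on
   non-measurable sets play no role; they are projections only for
   [spectral_dist] to be a total set function satisfying the interface of
   measures. *)
Record pvm : Type := Pvm {
  proj :> set (measurableTypeR R) -> {linear H -> H} ;
  proj_idem : forall M x, proj M (proj M x) = proj M x ;
  proj_sym : forall M x y, dot (proj M x) y = dot x (proj M y) ;
  proj0 : forall x, proj set0 x = 0 ;
  projT : forall x, proj setT x = x ;
  projI : forall M N x, measurable M -> measurable N ->
    proj (M `&` N) x = proj M (proj N x) ;
  proj_sigma_additive : forall x,
    semi_sigma_additive (fun M => (complex.Re (dot (proj M x) x))%:E)
}.

Definition spectral_dist (E : pvm) (x : H) (M : set (measurableTypeR R)) :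
    \bar R := (complex.Re (dot (E M x) x))%:E.

Section SpectralDistMeasure.
Variables (E : pvm) (x : H).

Let dist0 : spectral_dist E x set0 = 0%E.
Proof. by rewrite /spectral_dist proj0 linear0l raddf0. Qed.

Let dist_ge0 M : (0 <= spectral_dist E x M)%E.
Proof.
rewrite lee_fin -proj_idem proj_sym.
suff : 0 <= dot (E M x) (E M x) by rewrite lecE => /andP[].
have [->|/neq0_dnorm_gt0/ltW//] := eqVneq (E M x) 0.
by rewrite raddf0.
Qed.

HB.instance Definition _ := isMeasure.Build _ (measurableTypeR R) R
  (spectral_dist E x) dist0 dist_ge0 (@proj_sigma_additive E x).

End SpectralDistMeasure.

(* [S] is the integral of the real Borel function [f] with respect to [E]:
   x is in its domain iff |f|^2 is integrable for <E(.)x, x>, and <S x, x> is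
   then the integral of [f]; by polarization this determines [S].  When [E] is
   the spectral measure of [T], [S] is the operator f(T) of the functional
   calculus. *)
Definition spectral_integral (E : pvm) (f : R -> R) S : Prop :=
  [/\ linear_op S,
      dom S = [set x | (\int[spectral_dist E x]_l (f l ^+ 2)%:E < +oo)%E] &
      forall x, dom S x ->
        dot (S x) x = (Rintegral (spectral_dist E x) setT f)%:C%C].

Definition spectral_measure_of T (E : pvm) : Prop :=
  spectral_integral E id T.

End InnerProduct.
End Operators.

Arguments operator {R} H.
Arguments dform {R} H.

(* Main.v *)
Require Import Defs.
From mathcomp Require Import all_boot all_order all_algebra.
From mathcomp Require Import all_classical all_reals all_analysis.
From mathcomp Require Import sesquilinear complex.
From mathcomp Require Import measurable_realfun ring lra.

Set Implicit Arguments.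
Unset Strict Implicit.
Unset Printing Implicit Defensive.

Import Order.TTheory GRing.Theory Num.Theory.
Import numFieldNormedType.Exports.

Local Open Scope classical_set_scope.
Local Open Scope ring_scope.

(** Let D = Dom(A^{1/2}) and |x|_1 = |(A+I)^{1/2} x|.  The operators A^{1/2} and
(A+I)^{1/2} have the same domain and |x|_1^2 = |A^{1/2} x|^2 + |x|^2
([sqrt_addI]), so (A+I)^{1/2} is a unitary map from D with the norm |.|_1 onto
the whole space; call G its inverse.

Existence of B.  Off-diagonality of v and its symmetry make v[Jx, x] purely
imaginary, and J commutes with A^{1/2} ([sqrt_commutes]).  Therefore
     Re (b[Jx, x] + <Jx, Jx>) = |A^{1/2} x|^2 + |x|^2 = |x|_1^2,
whatever the size of beta: the form b + <., J.> is coercive on D up to the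
|.|_1-isometry J.  Carried to the whole space by G it is given by a bounded
self-adjoint operator F with |F q| >= |q|, which is thus a bijection
([lax_milgram]).  Hence B + J = (G F^{-1} G)^{-1} is self-adjoint, and so is B
([associated_operator]); moreover Dom(B) = G F^{-1} G (H) is |.|_1-dense in D.

Representation by B.  The identity <x, By> = <|B|^{1/2} x, sign(B) |B|^{1/2} y>
holds for y in Dom(B) ([spectral_form]).  If Dom(|B|^{1/2}) = D, the operator
|B|^{1/2} G is defined everywhere and has a densely defined adjoint, so it is
bounded by the uniform boundedness principle
([symmetric_relatively_bounded]).  Both b[x, y] and
<|B|^{1/2} x, sign(B) |B|^{1/2} y> are then |.|_1-continuous in y, and they
agree on a dense set ([form_represented]).

Kernel.  If Bx = 0 then |A^{1/2} x|^2 = Re b[Jx, x] = 0, so x is in Ker(A) and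
v[., x] = 0 on D.  Splitting x into its components for J, which stay in Ker(A),
and using that v vanishes between vectors of the same component
([off_diagonal]) gives one inclusion, and the other is immediate
([form_kernel]).

Two points carry most of the work.  Square roots of unbounded operators are
controlled through the resolvents (I + eT)^{-1}: these commute with the square
root S of T and tend strongly to the identity, so Dom(T) is a core of S
([sqrt_core]), and every statement on Dom(S) can be checked on Dom(T)
([form_domain_transfer]).  Functions of B are known only through the quadratic
forms <f(B)x, x>; these suffice to show that f(B) commutes with the spectral
projections ([si_commute]) and is nearly constant on the range of a small cell
([si_range_close]), and the product formula
<Bz, z> = <sign(B) |B|^{1/2} z, |B|^{1/2} z> follows by cutting the line into
small cells ([side_form]).

All estimates are made with the real inner product Re <x, y>; statements on
<x, y> itself are recovered by multiplying x by i. *)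

(** * The real inner product *)

Lemma ReB (R : realType) (c d : R[i]) :
  complex.Re (c - d) = complex.Re c - complex.Re d.
Proof. exact: raddfB. Qed.

Lemma ReN (R : realType) (c : R[i]) : complex.Re (- c) = - complex.Re c.
Proof. exact: raddfN. Qed.

Section RealInnerProduct.
Context {R : realType} {H : completeNormedModType R[i]}.
Variable dot : {dot H for Num.conj}.
Implicit Types (x y z : H) (t : R) (c : R[i]) (V : set H).

Definition rdot x y : R := complex.Re (dot x y).

(** The norm is recomputed from the inner product, with values in R instead of
R[i], so that the elementary estimates below hold for any inner product. *)
Definition nm x : R := Num.sqrt (rdot x x).

Lemma dotC x y : dot x y = (dot y x)^*.
Proof. by rewrite hermC expr0 mul1r. Qed.

Lemma dotDl x y z : dot (x + y) z = dot x z + dot y z.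
Proof. exact: linearDl. Qed.

Lemma dotDr x y z : dot x (y + z) = dot x y + dot x z.
Proof. exact: linearDr. Qed.

Lemma dotZl c x y : dot (c *: x) y = c * dot x y.
Proof. by rewrite linearZl_LR. Qed.

Lemma dotZr c x y : dot x (c *: y) = c^* * dot x y.
Proof. by rewrite linearZr_LR. Qed.

Lemma dotBl x y z : dot (x - y) z = dot x z - dot y z.
Proof. exact: linearBl. Qed.

Lemma dotBr x y z : dot x (y - z) = dot x y - dot x z.
Proof. exact: linearBr. Qed.

Lemma dotNl x y : dot (- x) y = - dot x y.
Proof. exact: linearNl. Qed.

Lemma dotNr x y : dot x (- y) = - dot x y.
Proof. exact: linearNr. Qed.

Lemma dot0l y : dot 0 y = 0.
Proof. exact: linear0l. Qed.

Lemma dot0r y : dot y 0 = 0.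
Proof. exact: linear0r. Qed.

Lemma dotxx x : dot x x = (rdot x x)%:C%C.
Proof.
have := dnorm_ge0 dot x; rewrite /rdot; case: (dot x x) => a b.
by rewrite lecE /= => /andP[/eqP -> _].
Qed.

Lemma rdotC x y : rdot x y = rdot y x.
Proof. by rewrite /rdot dotC; case: (dot y x). Qed.

Lemma rdotDl x y z : rdot (x + y) z = rdot x z + rdot y z.
Proof. by rewrite /rdot dotDl raddfD. Qed.

Lemma rdotDr x y z : rdot x (y + z) = rdot x y + rdot x z.
Proof. by rewrite /rdot dotDr raddfD. Qed.

Lemma rdotBl x y z : rdot (x - y) z = rdot x z - rdot y z.
Proof. by rewrite /rdot dotBl raddfB. Qed.

Lemma rdotBr x y z : rdot x (y - z) = rdot x y - rdot x z.
Proof. by rewrite /rdot dotBr raddfB. Qed.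

Lemma rdotNl x y : rdot (- x) y = - rdot x y.
Proof. by rewrite /rdot dotNl raddfN. Qed.

Lemma rdotNr x y : rdot x (- y) = - rdot x y.
Proof. by rewrite /rdot dotNr raddfN. Qed.

Lemma rdot0l y : rdot 0 y = 0.
Proof. by rewrite /rdot dot0l raddf0. Qed.

Lemma rdot0r y : rdot y 0 = 0.
Proof. by rewrite /rdot dot0r raddf0. Qed.

Lemma ReZ t (z : R[i]) : complex.Re (t%:C%C * z) = t * complex.Re z.
Proof. by case: z => a b /=; rewrite mul0r subr0. Qed.

Lemma rdotZl t x y : rdot (t%:C%C *: x) y = t * rdot x y.
Proof. by rewrite /rdot dotZl ReZ. Qed.

Lemma rdotZr t x y : rdot x (t%:C%C *: y) = t * rdot x y.
Proof. by rewrite rdotC rdotZl rdotC. Qed.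

Lemma rdotir x y : rdot x ('i%C *: y) = complex.Im (dot x y).
Proof. by rewrite /rdot dotZr; case: (dot x y) => a b /=; ring. Qed.

Lemma rdotii x y : rdot ('i%C *: x) ('i%C *: y) = rdot x y.
Proof. by rewrite /rdot dotZr dotZl; case: (dot x y) => a b /=; ring. Qed.

Lemma rdot_ge0 x : 0 <= rdot x x.
Proof. by have := dnorm_ge0 dot x; rewrite dotxx lecR. Qed.

Lemma rdot_eq0 x : rdot x x = 0 -> x = 0.
Proof. by move=> h; apply/eqP; rewrite -(dnorm_eq0 dot) dotxx h. Qed.

Lemma dot_rdot x y : dot x y = Complex (rdot x y) (rdot x ('i%C *: y)).
Proof. by rewrite rdotir /rdot; case: (dot x y). Qed.

Lemma nm_sqr x : nm x ^+ 2 = rdot x x.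
Proof. by rewrite sqr_sqrtr // rdot_ge0. Qed.

Lemma nm_ge0 x : 0 <= nm x. Proof. exact: sqrtr_ge0. Qed.

Lemma nm0 : nm 0 = 0. Proof. by rewrite /nm rdot0l sqrtr0. Qed.

Lemma nm_eq0 x : nm x = 0 -> x = 0.
Proof. by move=> h; apply: rdot_eq0; rewrite -nm_sqr h expr0n. Qed.

Lemma nmN x : nm (- x) = nm x.
Proof. by rewrite /nm rdotNl rdotNr opprK. Qed.

Lemma nmBC x y : nm (x - y) = nm (y - x).
Proof. by rewrite -nmN opprB. Qed.

Lemma nmi x : nm ('i%C *: x) = nm x.
Proof. by rewrite /nm rdotii. Qed.

Lemma nmZ t x : nm (t%:C%C *: x) = `|t| * nm x.
Proof.
by rewrite /nm rdotZl rdotZr mulrA -expr2 sqrtrM ?sqr_ge0// sqrtr_sqr.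
Qed.

Lemma nmZ_sqr t x : nm (t%:C%C *: x) ^+ 2 = t ^+ 2 * nm x ^+ 2.
Proof. by rewrite !nm_sqr rdotZl rdotZr mulrA. Qed.

Lemma nmD_sqr x y : nm (x + y) ^+ 2 = nm x ^+ 2 + 2 * rdot x y + nm y ^+ 2.
Proof. rewrite !nm_sqr rdotDl !rdotDr (rdotC y x); ring. Qed.

Lemma nmB_sqr x y : nm (x - y) ^+ 2 = nm x ^+ 2 - 2 * rdot x y + nm y ^+ 2.
Proof. by rewrite nmD_sqr nmN rdotNr; ring. Qed.

(** Cauchy-Schwarz: expand the square of the norm of |y| x - |x| y. *)
Lemma rdot_le x y : rdot x y <= nm x * nm y.
Proof.
have [/nm_eq0 ->|x0] := eqVneq (nm x) 0; first by rewrite rdot0l nm0 mul0r.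
have [/nm_eq0 ->|y0] := eqVneq (nm y) 0; first by rewrite rdot0r nm0 mulr0.
have := sqr_ge0 (nm ((nm y)%:C%C *: x - (nm x)%:C%C *: y)).
rewrite nmB_sqr !nmZ !ger0_norm ?nm_ge0// rdotZl rdotZr.
have px : 0 < nm x by rewrite lt_def x0 nm_ge0.
have py : 0 < nm y by rewrite lt_def y0 nm_ge0.
have pxy : 0 < nm x * nm y by rewrite mulr_gt0.
move=> h; rewrite -(ler_pM2l pxy); nra.
Qed.

Lemma rdot_norm_le x y : `|rdot x y| <= nm x * nm y.
Proof.
by rewrite ler_norml rdot_le andbT; have := rdot_le (- x) y; rewrite rdotNl nmN; lra.
Qed.

Lemma nmD x y : nm (x + y) <= nm x + nm y.
Proof.
rewrite -(@ler_pXn2r _ 2) ?nnegrE ?addr_ge0 ?nm_ge0// nmD_sqr sqrrD.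
have := rdot_le x y; lra.
Qed.

Lemma nmB_trans x y z : nm (x - z) <= nm (x - y) + nm (y - z).
Proof. by have := nmD (x - y) (y - z); rewrite addrA subrK. Qed.

Lemma nm_le_add x y : nm x <= nm y + nm (x - y).
Proof. by have := nmD y (x - y); rewrite addrCA subrr addr0. Qed.

Lemma parallelogram x y :
  nm (x + y) ^+ 2 + nm (x - y) ^+ 2 = 2 * nm x ^+ 2 + 2 * nm y ^+ 2.
Proof. rewrite nmD_sqr nmB_sqr; ring. Qed.

(** A complex subspace contains i y with y, so real orthogonality to it is
complex orthogonality. *)
Lemma dot_eq0_rdot V x : linear_subspace V ->
  (forall y, V y -> rdot x y = 0) -> forall y, V y -> dot x y = 0.
Proof.
move=> [V0 VP] h y Vy; rewrite dot_rdot h// h//.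
by have := VP 'i%C y 0 Vy V0; rewrite addr0.
Qed.

Lemma eq_dotr x y : (forall z, rdot z x = rdot z y) -> x = y.
Proof.
move=> h; apply/eqP; rewrite -subr_eq0; apply/eqP/rdot_eq0.
by rewrite rdotBr h subrr.
Qed.

(** Limit arguments below are brought to this form. *)
Lemma le_eps0 (q K : R) : (forall e : R, 0 < e -> q <= e * K) -> q <= 0.
Proof.
move=> h; rewrite leNgt; apply/negP => q0.
have K0 : 0 < K by rewrite ltNge; apply/negP => K0; have := h 1 ltr01; lra.
have := h (q / (2 * K)); rewrite divr_gt0 ?mulr_gt0// => /(_ isT).
have -> : q / (2 * K) * K = q / 2 by field; rewrite gt_eqF.
lra.
Qed.

(** Divide by t and let t tend to 0 from both sides: this is the first-order
condition at the minimum of a quadratic polynomial. *)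
Lemma quad_lin0 (a r : R) : (forall t, 0 <= t ^+ 2 * a - 2 * t * r) -> r = 0.
Proof.
move=> h; apply/eqP; rewrite eq_le -[X in _ && X]oppr_le0.
have h1 (s : R) : s ^+ 2 = 1 -> s * r <= 0.
  move=> s1; apply: (@le_eps0 _ (a / 2)) => e e0.
  have := h (s * e); rewrite exprMn s1 => h2.
  rewrite -(ler_pM2l e0); nra.
have := h1 1; have := h1 (-1); rewrite !(sqrrN, expr1n).
by move=> /(_ erefl) + /(_ erefl); rewrite mul1r mulN1r => -> ->.
Qed.

End RealInnerProduct.

(** * Projections, the Riesz representation, uniform boundedness *)

Section HilbertSpace.
Context {R : realType} {H : completeNormedModType R[i]}.
Context {dot : {dot H for Num.conj}} (Hdot : induces_norm dot).
Local Notation rd := (rdot dot).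
Local Notation nm := (nm dot).
Implicit Types (x y z : H) (t : R) (c : R[i]) (V K : set H).

(** This is where the inner product is tied to the topology of the space. *)
Lemma norm_nm x : `|x| = (nm x)%:C%C.
Proof.
apply/eqP; rewrite -(@eqrXn2 _ 2) ?normr_ge0 ?lecR ?nm_ge0//.
by rewrite -Hdot dotxx -nm_sqr rmorphXn.
Qed.

Lemma closure_nm V x :
  closure V x <-> forall e : R, 0 < e -> exists2 v, V v & nm (x - v) < e.
Proof.
split=> [clx e e0|h B].
  have [v [Vv]] := clx _ (@nbhsx_ballx _ _ x e%:C%C ltac:(by rewrite ltcR)).
  rewrite -ball_normE/= norm_nm ltcR => ?; by exists v.
move=> /nbhs_ballP[e /= e0 eB].
have eE : (complex.Re e)%:C%C = e by rewrite RRe_real// gtr0_real.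
have [v Vv ve] := h (complex.Re e) ltac:(by rewrite -ltcR eE).
exists v; split=> //; apply: eB; rewrite -ball_normE/= norm_nm.
by rewrite -eE ltcR.
Qed.

Lemma nm_complete (u : nat -> H) :
  (forall e : R, 0 < e -> exists N, forall m n, (N <= m)%N -> (N <= n)%N ->
     nm (u m - u n) < e) ->
  exists x, forall e : R, 0 < e -> exists N, forall n, (N <= n)%N ->
     nm (u n - x) < e.
Proof.
move=> uc.
have /cauchy_cvgP cu : cauchy (u @ \oo).
  apply: cauchy_exP => e e0.
  have eE : (complex.Re e)%:C%C = e by rewrite RRe_real// gtr0_real.
  have [N NP] := uc (complex.Re e) ltac:(by rewrite -ltcR eE).
  exists (u N); exists N => // n /= Nn.
  by rewrite -ball_normE/= norm_nm -eE ltcR NP.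
exists (lim (u @ \oo)) => e e0.
have e0' : 0 < e%:C%C :> R[i] by rewrite ltcR.
move/cvgrPdist_lt : cu => /(_ _ e0')[N _ NP]; exists N => n Nn.
by have := NP n Nn; rewrite /= norm_nm ltcR nmBC.
Qed.

Definition nm_closed V : Prop :=
  forall x, (forall e : R, 0 < e -> exists2 v, V v & nm (x - v) < e) -> V x.

Lemma subspaceD V x y : linear_subspace V -> V x -> V y -> V (x + y).
Proof. by move=> [_ VP] Vx Vy; rewrite -[x]scale1r; apply: VP. Qed.

Lemma subspaceZ V c x : linear_subspace V -> V x -> V (c *: x).
Proof. by move=> [V0 VP] Vx; rewrite -[_ *: _]addr0; apply: VP. Qed.

Lemma subspaceN V x : linear_subspace V -> V x -> V (- x).
Proof. by move=> VP Vx; rewrite -scaleN1r; apply: subspaceZ. Qed.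

Lemma subspaceB V x y : linear_subspace V -> V x -> V y -> V (x - y).
Proof. by move=> VP Vx Vy; apply: subspaceD => //; apply: subspaceN. Qed.

Lemma inv_nat_small (e : R) : 0 < e ->
  exists N, forall n, (N <= n)%N -> n.+1%:R^-1 < e.
Proof.
move=> e0; exists (Num.truncn (e^-1)) => n Nn.
rewrite invf_plt ?posrE ?ltr0n//.
apply: lt_le_trans (truncnS_gt _) _.
by rewrite ler_nat ltnS.
Qed.

(** A sequence in V minimizing the distance to x is Cauchy by the parallelogram
law; its limit realizes the distance, and the first-order condition at this
minimum is orthogonality. *)
Lemma projection V x : linear_subspace V -> nm_closed V ->
  exists2 p, V p & forall z, V z -> dot (x - p) z = 0.
Proof.
move=> VS Vcl.
pose D := [set nm (x - v) ^+ 2 | v in V].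
have D0 : has_inf D.
  split; first by exists (nm (x - 0) ^+ 2), 0 => //; exact: VS.1.
  by exists 0 => _ [v _ <-]; exact: sqr_ge0.
pose d := inf D.
have d0 : 0 <= d by apply: lb_le_inf; [exact: D0.1|move=> _ [v _ <-]; exact: sqr_ge0].
have dle v : V v -> d <= nm (x - v) ^+ 2.
  by move=> Vv; apply: ge_inf; [exact: D0.2|exists v].
have dlt (e : R) : 0 < e -> exists2 v, V v & nm (x - v) ^+ 2 < d + e.
  by move=> e0; have [_ [v Vv <-]] := inf_adherent e0 D0; exists v.
have /choice[v vP] : forall n : nat, exists v,
    V v /\ nm (x - v) ^+ 2 < d + n.+1%:R^-1.
  by move=> n; have [//|v Vv vd] := dlt n.+1%:R^-1; exists v.
(* two points of V that nearly realize the distance are close to each other,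
   since their midpoint is no closer to x *)
have close a b (e : R) : V a -> V b -> nm (x - a) ^+ 2 < d + e ->
    nm (x - b) ^+ 2 < d + e -> nm (a - b) ^+ 2 < 4 * e.
  move=> Va Vb ae be.
  have := parallelogram dot (x - a) (x - b).
  have -> : x - a - (x - b) = b - a by rewrite opprB addrC addrA subrK.
  have -> : x - a + (x - b) = 2%:C%C *: (x - 2^-1%:C%C *: (a + b)).
    rewrite scalerBr scalerA -rmorphM divff// scale1r rmorphD scalerDl scale1r.
    by rewrite opprD addrACA.
  rewrite nmZ_sqr nmBC.
  have := dle (2^-1%:C%C *: (a + b)) ltac:(by apply: subspaceZ => //; apply: subspaceD).
  nra.
have [e e0|p pP] := @nm_complete v.
  have e4 : 0 < e ^+ 2 / 4 by rewrite divr_gt0// exprn_gt0.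
  have [N NP] := inv_nat_small e4; exists N => m n Nm Nn.
  rewrite -(@ltr_pXn2r _ 2) ?nnegrE ?nm_ge0 ?ltW//.
  have -> : e ^+ 2 = 4 * (e ^+ 2 / 4) by field.
  apply: (close _ _ _ (vP m).1 (vP n).1).
    by apply: lt_trans (vP m).2 _; rewrite ltrD2l NP.
  by apply: lt_trans (vP n).2 _; rewrite ltrD2l NP.
have Vp : V p.
  by apply: Vcl => e /pP[N NP]; exists (v N); [exact: (vP N).1|rewrite nmBC NP].
have pd : nm (x - p) ^+ 2 <= d.
  rewrite -subr_le0; apply: (@le_eps0 _ _ (1 + 2 * (nm (x - p)))) => e e0.
  have [N NP] := pP _ e0; have [N' N'P] := inv_nat_small e0.
  pose n := maxn N N'.
  have h1 := NP n (leq_maxl _ _); have h2 := N'P n (leq_maxr _ _).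
  have h3 : nm (x - v n) ^+ 2 < d + e by apply: lt_trans (vP n).2 _; rewrite ltrD2l.
  have h4 := nm_le_add dot (x - p) (x - v n).
  move: h4; have -> : x - p - (x - v n) = v n - p by rewrite opprB addrC addrA subrK.
  move=> h4; have A0 := nm_ge0 dot (x - p); have B0 := nm_ge0 dot (x - v n).
  have [Ae|eA] := lerP (nm (x - p)) e; first by nra.
  have : (nm (x - p) - e) ^+ 2 <= nm (x - v n) ^+ 2.
    by rewrite ler_pXn2r ?nnegrE//; lra.
  have e2 := sqr_ge0 e; rewrite sqrrB mulrDr mulr1. nra.
exists p => //; apply: dot_eq0_rdot => // z Vz.
apply: (@quad_lin0 _ (nm z ^+ 2)) => t.
have := dle (p + t%:C%C *: z) ltac:(by apply: subspaceD => //; apply: subspaceZ).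
rewrite opprD addrA nmB_sqr nmZ_sqr rdotZr; lra.
Qed.

(** Bounding the real part suffices, since f (c x) = c f x for c = 1, -1, i, -i.
The kernel of f is closed, and f is a multiple of the inner product with a
vector orthogonal to it. *)
Lemma riesz (f : H -> R[i]) (M : R) :
  (forall c x y, f (c *: x + y) = c * f x + f y) ->
  (forall x, complex.Re (f x) <= M * nm x) -> exists w, forall x, f x = dot x w.
Proof.
move=> fL fM.
have f0 : f 0 = 0.
  have := fL 1 0 0; rewrite scaler0 addr0 mul1r => h.
  by apply: (addrI (f 0)); rewrite addr0.
have fZ c x : f (c *: x) = c * f x by rewrite -[c *: x]addr0 fL f0 addr0.
have fD x y : f (x + y) = f x + f y by rewrite -[x]scale1r fL mul1r scale1r.
have fN x : f (- x) = - f x by rewrite -scaleN1r fZ mulN1r.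
have [h|] := pselect (forall x, f x = 0).
  by exists 0 => x; rewrite h dot0r.
move/existsNP => [u fu].
have VS : linear_subspace [set x | f x = 0].
  by split=> [//|c x y /= fx fy]; rewrite fL fx fy mulr0 addr0.
have Vcl : nm_closed [set x | f x = 0].
  move=> x xP /=.
  have le0 c : (forall u, nm (c *: u) = nm u) -> complex.Re (c * f x) <= 0.
    move=> cN; apply: (@le_eps0 _ _ `|M|) => e /xP[v /= fv xv].
    have -> : c * f x = f (c *: (x - v)) by rewrite fZ fD fN fv subr0.
    apply: le_trans (fM _) _; rewrite cN mulrC.
    have h1 := ler_norm M; have h2 := nm_ge0 dot (x - v); have h3 := normr_ge0 M.
    nra.
  have := le0 1 (fun u => congr1 nm (scale1r u)).
  have := le0 (-1) (fun u => etrans (congr1 nm (scaleN1r u)) (nmN dot u)).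
  have := le0 'i%C (nmi dot).
  have hi z : nm ((- 'i%C) *: z) = nm z by rewrite scaleNr nmN nmi.
  have := le0 _ hi.
  case: (f x) => a b /= h1 h2 h3 h4.
  by apply/eqP; rewrite eq_complex /= !eq_le; apply/andP; split; apply/andP; split; lra.
have [p fp pP] := projection u VS Vcl.
pose w0 := u - p.
have fw0 : f w0 != 0 by rewrite /w0 fD fN fp subr0; apply/eqP.
have w00 : dot w0 w0 != 0.
  by rewrite (dnorm_eq0 dot); apply/eqP => w00; move: fw0; rewrite w00 f0 eqxx.
exists ((f w0 / dot w0 w0)^* *: w0) => x.
have : dot w0 (x - (f x / f w0) *: w0) = 0.
  by apply: pP => /=; rewrite fD fN fZ divfK// subrr.
rewrite dotC dotBl dotZl => /eqP; rewrite conjC_eq0 subr_eq0 => /eqP h.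
by rewrite dotZr conjCK h; field; apply/andP.
Qed.

(** The uniform boundedness principle, by a gliding hump.  If W is unbounded,
choose w_n in W of norm larger than 2 n 3^(n+1) and move a point x_n by exactly
3^-(n+1) in the direction of w_n or of - w_n, so that |<x_{n+1}, w_n>| is at least
3^-(n+1) |w_n|.  All later moves together amount to at most half of the n-th
one, so the limit p still has |<p, w_n>| >= 3^-(n+1) |w_n| / 2 >= n
for every n. *)
Lemma weakly_bounded (W : set H) :
  (forall p, exists M : R, forall w, W w -> `|rd p w| <= M) ->
  exists M : R, forall w, W w -> nm w <= M.
Proof.
move=> Wp; apply: contrapT => nW.
have Wbig (M : R) : exists w, W w /\ M < nm w.
  apply: contrapT => h; apply: nW; exists M => w Ww.
  by rewrite leNgt; apply/negP => Mw; apply: h; exists w.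
pose q : R := 3^-1.
have q0 : 0 < q by rewrite invr_gt0.
have q3 : q * 3 = 1 by rewrite mulVf.
have qn0 n : 0 < q ^+ n by rewrite exprn_gt0.
have /choice[w wP] : forall n : nat, exists w, W w /\ 2 * 3 ^+ n.+1 * n%:R < nm w.
  by move=> n; apply: Wbig.
have w0 n : 0 < nm (w n).
  by apply: le_lt_trans (wP n).2; rewrite !mulr_ge0// exprn_ge0.
pose t n := q ^+ n.+1 / nm (w n).
have t0 n : 0 < t n by rewrite divr_gt0.
have tw n : t n * nm (w n) = q ^+ n.+1 by rewrite mulfVK// gt_eqF.
pose step n x := if 0 <= rd x (w n) then x + (t n)%:C%C *: w n
                 else x - (t n)%:C%C *: w n.
have step_near n x : nm (step n x - x) = q ^+ n.+1.
  rewrite /step; case: ifP => _; rewrite addrAC subrr add0r ?nmN nmZ gtr0_norm//.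
have step_far n x : q ^+ n.+1 * nm (w n) <= `|rd (step n x) (w n)|.
  rewrite /step -tw; have ww := nm_sqr dot (w n); case: ifP => h.
    rewrite rdotDl rdotZl ger0_norm; first by rewrite -ww; nra.
    by rewrite addr_ge0// mulr_ge0// ?rdot_ge0// ltW.
  move/negbT : h; rewrite -ltNge => h.
  rewrite rdotBl rdotZl -ww ler0_norm; first by nra.
  by have := t0 n; have := sqr_ge0 (nm (w n)); nra.
pose x := fix x n := if n is n'.+1 then step n' (x n') else 0.
have xS n : x n.+1 = step n (x n) by [].
have xdist n k : nm (x (n + k)%N - x n) <= (q ^+ n - q ^+ (n + k)) / 2.
  elim: k => [|k IH]; first by rewrite addn0 subrr nm0 subrr mul0r.
  apply: le_trans (nmB_trans _ _ (x (n + k)%N) _) _.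
  rewrite addnS xS step_near exprS; have := qn0 (n + k)%N; have := q3; nra.
have xdist1 n m : (n <= m)%N -> nm (x m - x n) <= q ^+ n / 2.
  move=> nm_; have := xdist n (m - n)%N; rewrite subnKC//.
  have := qn0 m; lra.
have [e e0|p pP] := @nm_complete x.
  have [N NP] : exists N, q ^+ N < e.
    have [N NP] := inv_nat_small e0; exists N.
    apply: le_lt_trans (NP N (leqnn _)); rewrite /q exprVn lef_pV2 ?posrE ?ltr0n ?exprn_gt0//.
    by rewrite -natrX ler_nat ltn_expl.
  exists N => m n Nm Nn; apply: le_lt_trans (nmB_trans _ _ (x N) _) _.
  have := xdist1 _ _ Nm; have := xdist1 _ _ Nn; rewrite (nmBC _ _ (x n)); lra.
have pfar n : nm (p - x n) <= q ^+ n / 2.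
  rewrite -subr_le0; apply: (@le_eps0 _ _ 1) => e /pP[N NP].
  have := NP _ (leq_maxl N n); have := xdist1 _ _ (leq_maxr N n).
  have := nmB_trans dot p (x (maxn N n)) (x n); rewrite (nmBC _ p (x (maxn N n))); lra.
have [M MP] := Wp p.
have [n nM] : exists n : nat, M < n%:R.
  by exists (Num.truncn M).+1; apply: truncnS_gt.
have := MP _ (wP n).1; apply/negP; rewrite -ltNge.
apply: lt_trans nM _.
have h1 := step_far n (x n); rewrite -xS in h1.
have h2 : `|rd (x n.+1) (w n)| <= `|rd p (w n)| + `|rd (p - x n.+1) (w n)|.
  rewrite rdotBl.
  have := ler_normB (rd p (w n)) (rd p (w n) - rd (x n.+1) (w n)).
  by rewrite opprB addrC subrK.
have h3 : `|rd (p - x n.+1) (w n)| <= q ^+ n.+1 / 2 * nm (w n).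
  apply: le_trans (rdot_norm_le _ _ _) _; apply: ler_wpM2r; rewrite ?nm_ge0//.
have h4 : n%:R < q ^+ n.+1 / 2 * nm (w n).
  have := (wP n).2; rewrite -(ltr_pM2l (qn0 n.+1)).
  rewrite mulrA [q ^+ _ * (2 * _)]mulrCA -exprMn q3 expr1n; lra.
lra.
Qed.

End HilbertSpace.

Arguments nm_closed {R H} dot V.

(** * Self-adjoint operators and resolvents *)

Section OperatorBasics.
Context {R : realType} {H : completeNormedModType R[i]}.
Context {dot : {dot H for Num.conj}} (Hdot : induces_norm dot).
Local Notation rd := (rdot dot).
Local Notation nm := (nm dot).
Implicit Types (x y z : H) (t : R) (c : R[i]) (K : set H) (S T : operator H).

Lemma op_subspace T : linear_op T -> linear_subspace (dom T).
Proof. by case. Qed.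

Lemma opD T x y : linear_op T -> dom T x -> dom T y -> T (x + y) = T x + T y.
Proof. by move=> [_ TL] Tx Ty; rewrite -{1}[x]scale1r TL// scale1r. Qed.

Lemma op0 T : linear_op T -> T 0 = 0.
Proof.
move=> TL; have T0 := (op_subspace TL).1.
by apply: (addrI (T 0)); rewrite addr0 -(opD TL T0 T0) addr0.
Qed.

Lemma opZ T c x : linear_op T -> dom T x -> T (c *: x) = c *: T x.
Proof.
move=> TL Tx; rewrite -[c *: x]addr0 TL.2 ?op0 ?addr0//.
exact: (op_subspace TL).1.
Qed.

Lemma opN T x : linear_op T -> dom T x -> T (- x) = - T x.
Proof. by move=> TL Tx; rewrite -scaleN1r opZ// scaleN1r. Qed.

Lemma opB T x y : linear_op T -> dom T x -> dom T y -> T (x - y) = T x - T y.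
Proof.
by move=> TL Tx Ty; rewrite opD ?opN//; apply: subspaceN => //; exact: op_subspace.
Qed.

Lemma nonneg_rdot T x : nonneg_op dot T -> dom T x -> 0 <= rd (T x) x.
Proof. by move=> h /h; rewrite lecE => /andP[]. Qed.

Section SelfAdjoint.
Context {K : set H} {T : operator H} (Tsa : selfadjoint_in dot K T).

Lemma sa_linear : linear_op T. Proof. by case: Tsa. Qed.

Lemma sa_sub x : dom T x -> K x. Proof. by case: Tsa => _ + _ _; apply. Qed.

Lemma sa_dense x (e : R) : K x -> 0 < e -> exists2 y, dom T y & nm (x - y) < e.
Proof. by move=> Kx; case: Tsa => _ _ /(_ _ Kx)/(closure_nm Hdot) + _; apply. Qed.

Lemma sa_graph x : dom T x ->
  [/\ K x, K (T x) & forall y, dom T y -> dot (T y) x = dot y (T x)].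
Proof.
move=> Tx; case: Tsa => _ _ _ TE.
by have : graph T (x, T x) by []; rewrite -TE.
Qed.

Lemma sa_range x : dom T x -> K (T x). Proof. by case/sa_graph. Qed.

Lemma sa_sym x y : dom T x -> dom T y -> dot (T x) y = dot x (T y).
Proof. by move=> Tx /sa_graph[_ _]; apply. Qed.

Lemma sa_rsym x y : dom T x -> dom T y -> rd (T x) y = rd x (T y).
Proof. by move=> Tx Ty; rewrite /rdot sa_sym. Qed.

(** A self-adjoint operator has no proper symmetric extension. *)
Lemma sa_max x y : K x -> K y ->
  (forall z, dom T z -> dot (T z) x = dot z y) -> dom T x /\ T x = y.
Proof.
move=> Kx Ky h; case: Tsa => _ _ _ TE.
by have : adjoint_graph dot K T (x, y) by []; rewrite TE.
Qed.

End SelfAdjoint.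

(** Sequential closedness of the graph, stated with approximations instead of
sequences. *)
Definition op_closed T : Prop := forall x y,
  (forall e : R, 0 < e -> exists2 z, dom T z & nm (x - z) < e /\ nm (y - T z) < e) ->
  dom T x /\ T x = y.

Lemma sa_closed K T : nm_closed dot K -> selfadjoint_in dot K T -> op_closed T.
Proof.
move=> Kcl Tsa x y h.
apply: (sa_max Tsa).
- by apply: Kcl => e /h[z Tz [xz _]]; exists z => //; exact: (sa_sub Tsa).
- by apply: Kcl => e /h[z Tz [_ yz]]; exists (T z) => //; exact: (sa_range Tsa).
have hr w : dom T w -> rd (T w) x - rd w y = 0.
  move=> Tw; suff : `|rd (T w) x - rd w y| <= 0 by rewrite normr_le0 => /eqP.
  apply: (@le_eps0 _ _ (nm (T w) + nm w)) => e /h[z Tz [xz yz]].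
  have -> : rd (T w) x - rd w y = rd (T w) (x - z) - rd w (y - T z).
    by rewrite !rdotBr (sa_rsym Tsa Tw Tz); lra.
  apply: le_trans (ler_normB _ _) _; rewrite mulrDr; apply: lerD.
    apply: le_trans (rdot_norm_le _ _ _) _; rewrite mulrC.
    by apply: ler_wpM2r; rewrite ?nm_ge0// ltW.
  apply: le_trans (rdot_norm_le _ _ _) _; rewrite mulrC.
  by apply: ler_wpM2r; rewrite ?nm_ge0// ltW.
move=> w Tw; rewrite !dot_rdot.
have /eqP := hr _ Tw; rewrite subr_eq0 => /eqP ->.
have Tiw : dom T ((- 'i%C) *: w) by apply: subspaceZ => //; exact: op_subspace (sa_linear Tsa).
have /eqP := hr _ Tiw; rewrite subr_eq0 (opZ _ (sa_linear Tsa))// => /eqP.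
have ri u v : rd ((- 'i%C) *: u) v = rd u ('i%C *: v).
  by rewrite /rdot dotZl dotZr; case: (dot u v) => a b /=; ring.
by rewrite !ri => ->.
Qed.

(** The lower bound and the closedness of T make its range closed; a vector of K is
then the sum of a vector of the range and of one orthogonal to it. *)
Lemma surjective_of_bound K T (k : R) : linear_subspace K -> linear_op T ->
  op_closed T -> (forall x, dom T x -> K (T x)) ->
  0 < k -> (forall x, dom T x -> k * nm x <= nm (T x)) ->
  (forall w, K w -> (forall x, dom T x -> dot (T x) w = 0) -> w = 0) ->
  forall h, K h -> exists2 x, dom T x & T x = h.
Proof.
move=> KS TL Tcl TK k0 Tk TW h Kh.
pose V := [set T x | x in dom T].
have VS : linear_subspace V.
  split; first by exists 0; [exact: (op_subspace TL).1|exact: op0].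
  move=> c _ _ [x Tx <-] [y Ty <-]; exists (c *: x + y); last by rewrite TL.2.
  exact: (op_subspace TL).2.
have Vcl : nm_closed dot V.
  move=> y yP.
  have /choice[u uP] : forall n : nat, exists x, dom T x /\ nm (y - T x) < n.+1%:R^-1.
    by move=> n; have [//|_ [x Tx <-] xy] := yP n.+1%:R^-1; exists x.
  have Tu n := (uP n).1.
  have [e e0|x xP] := @nm_complete _ _ _ Hdot u.
    have ke : 0 < k * e / 2 by rewrite divr_gt0// mulr_gt0.
    have [N NP] := inv_nat_small ke; exists N => m n Nm Nn.
    rewrite -(ltr_pM2l k0); apply: le_lt_trans (Tk _ _) _.
      by apply: subspaceB => //; exact: op_subspace.
    rewrite opB//; have := nmB_trans dot (T (u m)) y (T (u n)).
    have := lt_trans (uP m).2 (NP _ Nm); have := lt_trans (uP n).2 (NP _ Nn).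
    rewrite (nmBC _ y (T (u m))); lra.
  have [Tx <-] : dom T x /\ T x = y; last by exists x.
  apply: Tcl => e e0; have [N NP] := xP _ e0; have [N' N'P] := inv_nat_small e0.
  exists (u (maxn N N')) => //; rewrite nmBC NP ?leq_maxl//; split=> //.
  by apply: lt_trans (uP _).2 _; apply: N'P; rewrite leq_maxr.
have [_ [x Tx <-] xP] := projection Hdot h VS Vcl.
exists x => //; apply/esym/eqP; rewrite -subr_eq0; apply/eqP/TW.
  by apply: subspaceB => //; exact: TK.
by move=> z Tz; rewrite dotC xP ?rmorph0//; exists z.
Qed.

(** Surjectivity of I + eT for e > 0: the consequence of self-adjointness on which
the study of square roots rests.  It passes at once to the restriction of T to a
reducing subspace. *)
Definition resolvents K T : Prop := forall e : R, 0 < e -> forall h, K h ->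
  exists2 x, dom T x & x + e%:C%C *: T x = h.

(** Nonnegativity of T gives |x + eTx| >= |x|, and a vector w orthogonal to the
range satisfies Tw = - w / e, hence <Tw, w> <= 0 and w = 0. *)
Lemma nonneg_resolvents K T : linear_subspace K -> nm_closed dot K ->
  selfadjoint_in dot K T -> nonneg_op dot T -> resolvents K T.
Proof.
move=> KS Kcl Tsa T0 e e0.
have TL := sa_linear Tsa; have TS := op_subspace TL.
have eN : e%:C%C != 0 :> R[i].
  by rewrite -(rmorph0 (real_complex R)) (inj_eq (@complexI R)) gt_eqF.
apply: (@surjective_of_bound K (Operator (dom T) (fun x => x + e%:C%C *: T x)) 1) => //=.
- split=> //= c x y Tx Ty.
  by rewrite TL.2// !scalerDr !scalerA (mulrC c) addrACA.
- move=> x y /= h.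
  have [|Tx TE] := @sa_closed _ _ Kcl Tsa x (e^-1%:C%C *: (y - x)).
    move=> d d0; have dd : 0 < Num.min d (e * d / 2).
      by rewrite lt_min d0 divr_gt0// mulr_gt0.
    have [z Tz []] := h _ dd; rewrite !lt_min => /andP[xz xz'] /andP[_ yz].
    exists z => //; split=> //.
    have -> : e^-1%:C%C *: (y - x) - T z =
        e^-1%:C%C *: ((y - (z + e%:C%C *: T z)) - (x - z)).
      have -> : y - (z + e%:C%C *: T z) - (x - z) = (y - x) - e%:C%C *: T z.
        by rewrite opprB opprD !addrA (addrAC _ (- (_ *: T z))) subrK addrAC.
      by rewrite [RHS]scalerBr scalerA -rmorphM mulVf ?gt_eqF// scale1r.
    rewrite nmZ gtr0_norm ?invr_gt0// mulrC ltr_pdivrMr//.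
    apply: le_lt_trans (nmD _ _ _) _; rewrite nmN; lra.
  split=> //; rewrite TE scalerA -rmorphM divff ?gt_eqF// scale1r.
  by rewrite addrC subrK.
- move=> x Tx; apply: subspaceD => //; first exact: (sa_sub Tsa).
  by apply: subspaceZ => //; exact: (sa_range Tsa).
- move=> x Tx; rewrite mul1r -(@ler_pXn2r _ 2) ?nnegrE ?nm_ge0//.
  rewrite nmD_sqr nmZ_sqr rdotZr rdotC.
  have := nonneg_rdot T0 Tx; have := sqr_ge0 (nm (T x)); nra.
move=> w Kw h.
have [|||Tw TE] := @sa_max _ _ Tsa w (- (e^-1%:C%C *: w)) => //.
- by apply: subspaceN => //; apply: subspaceZ.
- move=> z Tz; have := h z Tz; rewrite dotDl dotZl => /eqP.
  rewrite addr_eq0 dotNr dotZr => /eqP ->.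
  have -> : (e^-1%:C%C)^* = (e%:C%C)^-1 :> R[i].
    by rewrite -fmorphV /=; congr Complex; rewrite oppr0.
  by rewrite mulrN opprK mulKf.
have := nonneg_rdot T0 Tw; rewrite TE rdotNl rdotZl -nm_sqr oppr_ge0 => h1.
apply: (@nm_eq0 _ _ dot); apply/eqP; rewrite -sqrf_eq0 eq_le sqr_ge0 andbT.
by move: h1; rewrite pmulr_rle0// invr_gt0.
Qed.

End OperatorBasics.

Arguments op_closed {R H} dot T.

(** * Cores and domains of square roots *)

Section SquareRoot.
Context {R : realType} {H : completeNormedModType R[i]}.
Context {dot : {dot H for Num.conj}} (Hdot : induces_norm dot).
Local Notation rd := (rdot dot).
Local Notation nm := (nm dot).
Implicit Types (x y z : H) (t : R) (c : R[i]) (K : set H) (S T : operator H).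

Lemma sqrt_dom K T S x : is_sqrt_in dot K T S ->
  dom T x <-> dom S x /\ dom S (S x).
Proof.
move=> [_ _ E]; split=> [Tx|Sx].
  have : graph T (x, T x) by [].
  by rewrite -E => -[].
have : graph (op_comp S S) (x, S (S x)) by [].
by rewrite E => -[].
Qed.

Lemma sqrtE K T S x : is_sqrt_in dot K T S -> dom T x -> T x = S (S x).
Proof.
move=> [_ _ E] Tx; have : graph T (x, T x) by [].
by rewrite -E => -[].
Qed.

Lemma sqrt_sub K T S x : is_sqrt_in dot K T S -> dom T x -> dom S x.
Proof. by move=> h /(sqrt_dom x h)[]. Qed.

Lemma sqrt_form K T S x y : is_sqrt_in dot K T S -> dom T x -> dom S y ->
  rd (T x) y = rd (S x) (S y).
Proof.
move=> h Tx Sy; have [Sx SSx] := (sqrt_dom x h).1 Tx.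
by rewrite (sqrtE h Tx); case: h => h _ _; rewrite (sa_rsym h).
Qed.

Lemma sqrt_nm K T S x : is_sqrt_in dot K T S -> dom T x ->
  nm (S x) ^+ 2 = rd (T x) x.
Proof. by move=> h Tx; rewrite (sqrt_form h Tx (sqrt_sub h Tx)) nm_sqr. Qed.

Definition core_of T S : Prop := forall x (e : R), dom S x -> 0 < e ->
  exists2 y, dom T y & nm (x - y) < e /\ nm (S x - S y) < e.

Lemma sqrt_resolvent_contraction K T S (e : R) x : is_sqrt_in dot K T S ->
  0 < e -> dom T x -> nm x <= nm (x + e%:C%C *: T x).
Proof.
move=> h e0 Tx; rewrite -(@ler_pXn2r _ 2) ?nnegrE ?nm_ge0//.
rewrite nmD_sqr nmZ_sqr rdotZr rdotC -(sqrt_nm h Tx).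
by have := sqr_ge0 (nm (S x)); have := sqr_ge0 (nm (T x)); nra.
Qed.

(** Apply S to the equation y + eTy = x, where T = S S. *)
Lemma sqrt_resolvent_commutes K T S (e : R) x y : is_sqrt_in dot K T S ->
  0 < e -> dom T y -> dom S x -> y + e%:C%C *: T y = x ->
  dom T (S y) /\ S y + e%:C%C *: T (S y) = S x.
Proof.
move=> h e0 Ty Sx yx; have [Sy SSy] := (sqrt_dom y h).1 Ty.
have [hS _ _] := h; have SL := sa_linear hS.
have TyE : T y = e^-1%:C%C *: (x - y).
  by rewrite -yx addrC addKr scalerA -rmorphM mulVf ?gt_eqF// scale1r.
have STy : dom S (T y).
  by rewrite TyE; apply: subspaceZ; [|apply: subspaceB => //]; exact: op_subspace.
have TSy : dom T (S y) by apply/(sqrt_dom _ h); rewrite -(sqrtE h Ty).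
split=> //; rewrite (sqrtE h TSy) -(sqrtE h Ty) -yx opD//; last first.
  by apply: subspaceZ => //; exact: op_subspace.
by rewrite opZ.
Qed.

(** With y = (I + eT)^{-1} x one has |x - y|^2 = e <Ty, x - y> =
e (<Sx, Sy> - |Sy|^2), and this is at most e |Sx|^2 / 4. *)
Lemma sqrt_resolvent_approx K T S (e : R) x y : is_sqrt_in dot K T S ->
  0 < e -> dom T y -> dom S x -> y + e%:C%C *: T y = x ->
  nm (x - y) ^+ 2 <= e * nm (S x) ^+ 2.
Proof.
move=> h e0 Ty Sx yx; have Sy := sqrt_sub h Ty.
have [hS _ _] := h; have SL := sa_linear hS.
have Sxy : dom S (x - y) by apply: subspaceB => //; exact: op_subspace.
have -> : nm (x - y) ^+ 2 = e * (rd (S x) (S y) - nm (S y) ^+ 2).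
  rewrite nm_sqr -{1}yx addrC addKr rdotZl (sqrt_form h Ty Sxy).
  by rewrite opB// rdotBr nm_sqr rdotC.
rewrite ler_pM2l//; have := rdot_le dot (S x) (S y).
have := sqr_ge0 (nm (S x) - nm (S y)); have := sqr_ge0 (nm (S x)).
by have := sqr_ge0 (nm (S y)); rewrite sqrrB; nra.
Qed.

(** Approximate x by y = (I + dT)^{-1} x with d small.  Then Sy is
(I + dT)^{-1} Sx, which is close to Sx: compare with (I + dT)^{-1} z for some z in
Dom(S) close to Sx.  The vector Sx itself need not lie in Dom(S), so
[sqrt_resolvent_approx] does not apply to it directly. *)
Lemma sqrt_core K T S : is_sqrt_in dot K T S -> resolvents K T -> core_of T S.
Proof.
move=> h hR x e Sx e0; have [hS _ _] := h; have SL := sa_linear hS.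
have SS := op_subspace SL.
have e3 : 0 < e / 3 by rewrite divr_gt0.
have [z Sz Sxz] := sa_dense Hdot hS (sa_range hS Sx) e3.
(* d is such that the errors of [sqrt_resolvent_approx] at x and at z are both
   at most e / 3 *)
pose k := 1 + nm (S x) ^+ 2 + nm (S z) ^+ 2.
have k0 : 0 < k by rewrite /k; have := sqr_ge0 (nm (S x)); have := sqr_ge0 (nm (S z)); lra.
pose d := (e / 3) ^+ 2 / k.
have d0 : 0 < d by rewrite divr_gt0// exprn_gt0.
have dk : d * k = (e / 3) ^+ 2 by rewrite mulfVK// gt_eqF.
have [y Ty yx] := hR d d0 x (sa_sub hS Sx).
have [w Tw wz] := hR d d0 z (sa_sub hS Sz).
have small u v : nm u ^+ 2 <= d * nm (S v) ^+ 2 -> nm (S v) ^+ 2 <= k -> nm u <= e / 3.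
  move=> h1 h2; rewrite -(@ler_pXn2r _ 2) ?nnegrE ?nm_ge0 ?(ltW e3)// -dk.
  by apply: le_trans h1 _; rewrite ler_pM2l.
have xy : nm (x - y) <= e / 3.
  apply: small (sqrt_resolvent_approx h d0 Ty Sx yx) _.
  by rewrite /k; have := sqr_ge0 (nm (S z)); lra.
have zw : nm (z - w) <= e / 3.
  apply: small (sqrt_resolvent_approx h d0 Tw Sz wz) _.
  by rewrite /k; have := sqr_ge0 (nm (S x)); lra.
have [TSy SyE] := sqrt_resolvent_commutes h d0 Ty Sx yx.
have wSy : nm (w - S y) <= e / 3.
  apply: ltW; apply: le_lt_trans Sxz; rewrite nmBC.
  have Tww : dom T (S y - w).
    have Sw := sqrt_sub h Tw; apply/(sqrt_dom _ h).
    have [? ?] := (sqrt_dom _ h).1 TSy; have [? ?] := (sqrt_dom _ h).1 Tw.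
    by rewrite opB//; split; apply: subspaceB.
  rewrite -SyE -wz.
  apply: le_trans (sqrt_resolvent_contraction h d0 Tww) _.
  rewrite le_eqVlt; apply/orP; left; apply/eqP; congr (nm _).
  have [Sy' SSy'] := (sqrt_dom _ h).1 TSy; have [Sw' SSw'] := (sqrt_dom _ h).1 Tw.
  rewrite (sqrtE h Tww) (sqrtE h TSy) (sqrtE h Tw) !opB//.
  by rewrite scalerBr opprD addrACA.
exists y => //; split; first lra.
have := nmB_trans dot (S x) z (S y); have := nmB_trans dot z w (S y); lra.
Qed.

Lemma sqr_close (a b e : R) : 0 <= a -> 0 <= b -> 0 < e -> e <= 1 ->
  `|a - b| <= e -> `|a ^+ 2 - b ^+ 2| <= e * (2 * a + 1).
Proof.
move=> a0 b0 e0 e1; rewrite !ler_norml => /andP[h1 h2]; apply/andP; split; nra.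
Qed.

Lemma nm_dist x y : `|nm x - nm y| <= nm (x - y).
Proof.
have h1 := nm_le_add dot x y; have h2 := nm_le_add dot y x.
by rewrite ler_norml; rewrite (nmBC _ y x) in h2; apply/andP; split; lra.
Qed.

(** If p maps a core of S into Dom(S') and satisfies a quadratic form estimate
there, approximate x in Dom(S) by u_n in the core: S' (p u_n) is Cauchy, and
closedness of S' carries both the domain inclusion and the estimate to the
limit.  The coefficients a and g may have any sign, so that with p the identity
this yields exact identities between quadratic forms. *)
Lemma form_domain_transfer T S S' (p : H -> H) (k a g : R) :
  core_of T S -> linear_op S' -> op_closed dot S' -> linear_op S ->
  linear_subspace (dom T) -> dom T `<=` dom S ->
  (forall x y, p (x - y) = p x - p y) -> (forall x, nm (p x) <= k * nm x) ->
  (forall x, dom T x -> dom S' (p x) /\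
     nm (S' (p x)) ^+ 2 <= a * nm (S x) ^+ 2 + g * nm x ^+ 2) ->
  forall x, dom S x -> dom S' (p x) /\
     nm (S' (p x)) ^+ 2 <= a * nm (S x) ^+ 2 + g * nm x ^+ 2.
Proof.
move=> hc SL' S'cl SL TS TSub pB pk hp x Sx.
have /choice[u uP] : forall n : nat, exists y, dom T y /\
    (nm (x - y) < n.+1%:R^-1 /\ nm (S x - S y) < n.+1%:R^-1).
  by move=> n; have [//|y Ty h] := hc x n.+1%:R^-1 Sx; exists y.
have Tu n : dom T (u n) := (uP n).1.
have Su n : dom S (u n) := TSub _ (Tu n).
have Spu n : dom S' (p (u n)) := (hp _ (Tu n)).1.
have small (e : R) : 0 < e -> exists N, forall n, (N <= n)%N ->
    nm (x - u n) < e /\ nm (S x - S (u n)) < e.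
  move=> e0; have [N NP] := inv_nat_small e0; exists N => n Nn.
  by have [_ [h1 h2]] := uP n; split; [apply: lt_trans h1 _|apply: lt_trans h2 _]; apply: NP.
pose b := `|a| + `|g|.
have b0 : 0 <= b by rewrite addr_ge0.
have diff m n (e : R) : 0 < e -> nm (x - u m) < e -> nm (S x - S (u m)) < e ->
    nm (x - u n) < e -> nm (S x - S (u n)) < e ->
    nm (S' (p (u m)) - S' (p (u n))) ^+ 2 <= b * (2 * e) ^+ 2.
  move=> e0 h1 h2 h3 h4.
  have [_] := hp (u m - u n) (subspaceB TS (Tu m) (Tu n)).
  rewrite pB !opB// => hh; apply: le_trans hh _.
  have h5 : nm (u m - u n) <= 2 * e.
    by have := nmB_trans dot (u m) x (u n); rewrite (nmBC _ (u m) x); lra.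
  have h6 : nm (S (u m) - S (u n)) <= 2 * e.
    by have := nmB_trans dot (S (u m)) (S x) (S (u n)); rewrite (nmBC _ (S (u m)) (S x)); lra.
  have h7 : nm (u m - u n) ^+ 2 <= (2 * e) ^+ 2.
    by rewrite ler_pXn2r ?nnegrE ?nm_ge0//; lra.
  have h8 : nm (S (u m) - S (u n)) ^+ 2 <= (2 * e) ^+ 2.
    by rewrite ler_pXn2r ?nnegrE ?nm_ge0//; lra.
  have le (c X Y : R) : 0 <= X -> X <= Y -> c * X <= `|c| * Y.
    move=> X0 XY; apply: le_trans (ler_wpM2l (normr_ge0 _) XY).
    by apply: ler_wpM2r => //; apply: ler_norm.
  by rewrite mulrDl; apply: lerD; apply: le; rewrite ?sqr_ge0.
have [e e0|q qP] := @nm_complete _ _ _ Hdot (fun n => S' (p (u n))).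
  pose d := e / (2 * (1 + b)) / 2.
  have d0 : 0 < d by rewrite !divr_gt0// mulr_gt0//; lra.
  have dE : d * (4 * (1 + b)) = e by rewrite /d; field; rewrite gt_eqF//; lra.
  have [N NP] := small d d0; exists N => m n Nm Nn.
  have [h1 h2] := NP _ Nm; have [h3 h4] := NP _ Nn.
  rewrite -(@ltr_pXn2r _ 2) ?nnegrE ?nm_ge0 ?ltW//.
  apply: le_lt_trans (diff _ _ _ d0 h1 h2 h3 h4) _.
  have hb : 4 * b < 16 * (1 + b) ^+ 2 by nra.
  rewrite -subr_gt0.
  have -> : e ^+ 2 - b * (2 * d) ^+ 2 = d ^+ 2 * (16 * (1 + b) ^+ 2 - 4 * b).
    by rewrite -dE; ring.
  by rewrite mulr_gt0 ?subr_gt0// exprn_gt0.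
have [Spx qE] : dom S' (p x) /\ S' (p x) = q.
  apply: S'cl => e e0.
  have [N NP] := qP e e0.
  have e1 : 0 < e / (`|k| + 1) by rewrite divr_gt0// ltr_wpDl.
  have [N' N'P] := small _ e1.
  exists (p (u (maxn N N'))) => //; split; last by rewrite nmBC NP// leq_maxl.
  rewrite -pB; apply: le_lt_trans (pk _) _.
  have [h _] := N'P _ (leq_maxr N N'); rewrite ltr_pdivlMr ?ltr_wpDl// in h.
  apply: le_lt_trans h; rewrite mulrC; apply: ler_wpM2l; rewrite ?nm_ge0//.
  by have := ler_norm k; lra.
split=> //; rewrite qE -subr_le0.
pose k' := (2 * nm q + 1) + `|a| * (2 * nm (S x) + 1) + `|g| * (2 * nm x + 1).
apply: (@le_eps0 _ _ k') => e e0; rewrite /k'.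
pose d := Num.min e 1.
have d0 : 0 < d by rewrite lt_min e0 ltr01.
have de : d <= e by rewrite ge_min lexx.
have d1 : d <= 1 by rewrite ge_min lexx orbT.
have [N NP] := qP _ d0; have [N' N'P] := small _ d0.
pose n := maxn N N'.
have h1 := NP n (leq_maxl _ _); have [h2 h3] := N'P n (leq_maxr _ _).
have cl u' v' : nm (u' - v') < d -> `|nm u' ^+ 2 - nm v' ^+ 2| <= e * (2 * nm u' + 1).
  move=> uv; apply: le_trans (_ : d * (2 * nm u' + 1) <= _).
    apply: sqr_close; rewrite ?nm_ge0//; apply: le_trans (nm_dist _ _) _; exact: ltW.
  by apply: ler_wpM2r => //; have := nm_ge0 dot u'; lra.
have c1 := cl q (S' (p (u n))); rewrite (nmBC _ q) in c1; have {c1} := c1 h1.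
have := cl _ _ h2; have := cl _ _ h3.
have [_] := hp _ (Tu n).
rewrite !ler_norml => c0 /andP[c1 c2] /andP[c3 c4] /andP[c5 c6].
have a1 : a * (nm (S (u n)) ^+ 2 - nm (S x) ^+ 2) <= e * (`|a| * (2 * nm (S x) + 1)).
  apply: le_trans (ler_norm _) _; rewrite normrM mulrCA; apply: ler_wpM2l => //.
  by rewrite ler_norml; apply/andP; split; lra.
have a2 : g * (nm (u n) ^+ 2 - nm x ^+ 2) <= e * (`|g| * (2 * nm x + 1)).
  apply: le_trans (ler_norm _) _; rewrite normrM mulrCA; apply: ler_wpM2l => //.
  by rewrite ler_norml; apply/andP; split; lra.
rewrite 2![e * (_ + _)]mulrDr; move: c0 a1 a2; rewrite !mulrBr; lra.
Qed.

(** Polarization and the parallelogram law, after rescaling x and y to vectors of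
equal norm. *)
Lemma symmetric_form_bound (V : set H) (g : H -> H -> R) (N : R) :
  (forall x y, V x -> V y -> V (x + y)) ->
  (forall t x, V x -> V (t%:C%C *: x)) ->
  (forall x y z, V x -> V y -> V z -> g (x + y) z = g x z + g y z) ->
  (forall t x y, V x -> V y -> g (t%:C%C *: x) y = t * g x y) ->
  (forall x y, V x -> V y -> g x y = g y x) ->
  (forall x, V x -> `|g x x| <= N * nm x ^+ 2) ->
  forall x y, V x -> V y -> g x y <= N * nm x * nm y.
Proof.
move=> VD VZ gD gZ gC gN x y Vx Vy.
have g0 u : V u -> g 0 u = 0.
  by move=> Vu; have := gZ 0 _ _ Vu Vu; rewrite rmorph0 scale0r mul0r.
have [/nm_eq0 x0|x0] := eqVneq (nm x) 0.
  by rewrite x0 g0// nm0 mulr0 mul0r.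
have [/nm_eq0 y0|y0] := eqVneq (nm y) 0.
  by rewrite y0 gC -?y0// y0 g0// nm0 mulr0.
have px : 0 < nm x by rewrite lt_def x0 nm_ge0.
have py : 0 < nm y by rewrite lt_def y0 nm_ge0.
(* u and w have the same norm *)
pose u := (nm y)%:C%C *: x; pose w := (nm x)%:C%C *: y; pose w' := (- nm x)%:C%C *: y.
have [Vu Vw Vw'] : [/\ V u, V w & V w'] by split; exact: VZ.
have guw : g u w = nm x * nm y * g x y.
  by rewrite /u gZ// gC// gZ// gC//; ring.
have gw' z : V z -> g w' z = - g w z by move=> Vz; rewrite !gZ// mulNr.
have E : g (u + w) (u + w) - g (u + w') (u + w') = 4 * g u w.
  have [Vuw Vuw'] : V (u + w) /\ V (u + w') by split; exact: VD.
  rewrite !gD// !gw'// (gC u (u + w))// (gC w (u + w))// (gC u (u + w'))// (gC w (u + w'))//.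
  rewrite !gD// !gw'// (gC u w)//; lra.
have h1 := gN _ (VD _ _ Vu Vw); have h2 := gN _ (VD _ _ Vu Vw').
have := parallelogram dot u w; have -> : u - w = u + w' by rewrite /w' rmorphN scaleNr.
rewrite !nmZ_sqr => par.
have xy : 0 < 4 * (nm x * nm y) by rewrite !mulr_gt0.
rewrite -(ler_pM2l xy) -[X in X <= _]mulrA -guw -E.
have -> : 4 * (nm x * nm y) * (N * nm x * nm y) = N * nm (u + w) ^+ 2 + N * nm (u + w') ^+ 2.
  by rewrite -mulrDr par; ring.
by move: h1 h2; rewrite !ler_norml => /andP[_ h1] /andP[h2 _]; lra.
Qed.

Lemma numerical_radius (V : set H) (X : H -> H) (N : R) :
  (forall x y, V x -> V y -> V (x + y)) ->
  (forall t x, V x -> V (t%:C%C *: x)) ->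
  (forall x, V x -> V (X x)) ->
  (forall x y, V x -> V y -> X (x + y) = X x + X y) ->
  (forall t x, V x -> X (t%:C%C *: x) = t%:C%C *: X x) ->
  (forall x y, V x -> V y -> rd (X x) y = rd x (X y)) ->
  (forall x, V x -> `|rd (X x) x| <= N * nm x ^+ 2) ->
  forall x, V x -> nm (X x) <= N * nm x.
Proof.
move=> VD VZ VX XD XZ Xs XN x Vx.
have : rd (X x) (X x) <= N * nm x * nm (X x).
  apply: (@symmetric_form_bound V (fun u w => rd (X u) w)) => //; last exact: VX.
  - by move=> u w z Vu Vw _; rewrite XD// rdotDl.
  - by move=> t u w Vu _; rewrite XZ// rdotZl.
  - by move=> u w Vu Vw; rewrite Xs// rdotC.
rewrite -nm_sqr expr2 => h.
have [X0|X0] := eqVneq (nm (X x)) 0; last first.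
  by rewrite -(@ler_pM2r _ (nm (X x)))// lt_def X0 nm_ge0.
have [x0|x0] := eqVneq (nm x) 0; first by rewrite X0 x0 mulr0.
rewrite X0; have := le_trans (normr_ge0 _) (XN x Vx).
have px : 0 < nm x by rewrite lt_def x0 nm_ge0.
by rewrite pmulr_lge0 ?exprn_gt0// => N0; rewrite mulr_ge0// ltW.
Qed.

End SquareRoot.
Arguments core_of {R H} dot T S.

(** * Uniqueness of bounded square roots *)

Section SquareRootUniqueness.
Context {R : realType} {H : completeNormedModType R[i]}.
Context {dot : {dot H for Num.conj}} (Hdot : induces_norm dot).
Local Notation rd := (rdot dot).
Local Notation nm := (nm dot).
Implicit Types (x y z : H) (t : R) (c : R[i]) (K : set H) (S T : operator H).

Definition bounded_nonneg (P : H -> H) (M : R) : Prop :=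
  [/\ forall x y, P (x + y) = P x + P y,
      forall t x, P (t%:C%C *: x) = t%:C%C *: P x,
      forall x y, rd (P x) y = rd x (P y),
      forall x, 0 <= rd (P x) x &
      forall x, nm (P x) <= M * nm x].

(** Put X = P - Q and K = P + Q.  P and Q may fail to commute, but
KX + XK = 2 (P^2 - Q^2) = 0, so Re <Ku, Xu> = 0 for every u.  Let u be a unit
vector and l = Re <Xu, u>.  On the one hand |l| <= Re <Ku, u>; on the other hand
l Re <Ku, u> = - Re <Ku, Xu - l u>, and |Xu - l u|^2 <= N^2 - l^2, where N is the
numerical radius of X.  Hence l^4 <= (2M)^2 (N^2 - l^2), and letting |l| tend to N
gives N = 0. *)
Lemma bounded_sqrt_unique (P Q : H -> H) (M : R) :
  bounded_nonneg P M -> bounded_nonneg Q M ->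
  (forall x, P (P x) = Q (Q x)) -> forall x, P x = Q x.
Proof.
move=> [PD PZ Ps P0 PM] [QD QZ Qs Q0 QM] PQ.
pose X x := P x - Q x.
have XD x y : X (x + y) = X x + X y by rewrite /X PD QD opprD addrACA.
have XZ t x : X (t%:C%C *: x) = t%:C%C *: X x by rewrite /X PZ QZ scalerBr.
have Xs x y : rd (X x) y = rd x (X y) by rewrite /X rdotBl rdotBr Ps Qs.
have M0 : (forall x, nm x = 0) \/ 0 <= M.
  have [|Mn] := lerP 0 M; [by right|left=> z].
  by have := PM z; have := nm_ge0 dot z; have := nm_ge0 dot (P z); nra.
case: M0 => [n0|M0] x.
  by apply/eqP; rewrite -subr_eq0; apply/eqP; apply: (@nm_eq0 _ _ dot).
suff X0 : nm (X x) <= 0.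
  apply/eqP; rewrite -subr_eq0; apply/eqP; apply: (@nm_eq0 _ _ dot).
  by apply/eqP; rewrite eq_le X0 nm_ge0.
pose D : set R := [set `|rd (X u) u| | u in [set u | nm u = 1]].
have [u1|] := pselect (exists u, nm u = 1); last first.
  move=> h; have [/nm_eq0 ->|x0] := eqVneq (nm x) 0.
    by have := XZ 0 0; rewrite rmorph0 !scale0r => ->; rewrite nm0.
  exfalso; apply: h; exists ((nm x)^-1%:C%C *: x).
  by rewrite nmZ ger0_norm ?invr_ge0 ?nm_ge0// mulVf.
have XM u : nm u = 1 -> `|rd (X u) u| <= 2 * M.
  move=> u1'; rewrite /X rdotBl; apply: le_trans (ler_normB _ _) _.
  have := rdot_norm_le dot (P u) u; have := rdot_norm_le dot (Q u) u.
  by have := PM u; have := QM u; rewrite u1'; lra.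
have DS : has_sup D.
  split; first by case: u1 => u u1; exists `|rd (X u) u|, u.
  by exists (2 * M) => _ [u u1' <-]; apply: XM.
pose N := sup D.
have DN u : nm u = 1 -> `|rd (X u) u| <= N.
  by move=> uu; apply: ub_le_sup; [exact: DS.2|exists u].
have N0 : 0 <= N by case: u1 => u /DN; apply: le_trans.
have XN u : `|rd (X u) u| <= N * nm u ^+ 2.
  have [/nm_eq0 ->|u0] := eqVneq (nm u) 0.
    by rewrite rdot0r normr0 nm0 expr0n mulr0.
  have pu : 0 < nm u by rewrite lt_def u0 nm_ge0.
  have := DN ((nm u)^-1%:C%C *: u).
  rewrite nmZ ger0_norm ?invr_ge0 ?nm_ge0// mulVf// => /(_ erefl).
  rewrite XZ rdotZl rdotZr !normrM ger0_norm ?invr_ge0 ?nm_ge0// mulrA -expr2.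
  by rewrite exprVn mulrC ler_pdivrMr// exprn_gt0.
have XNn u : nm (X u) <= N * nm u.
  by apply: (@numerical_radius _ _ dot setT) => // *; [exact: XD|exact: XZ].
have NE : N = 0.
  have key : forall u, nm u = 1 ->
      (rd (X u) u) ^+ 4 <= 4 * M ^+ 2 * (N ^+ 2 - (rd (X u) u) ^+ 2).
    move=> u uu; set l := rd (X u) u.
    pose K := P u + Q u.
    have KX : rd K (X u) = 0.
      rewrite /K /X rdotDl !rdotBr (rdotC _ (Q u) (P u)).
      have -> : rd (P u) (P u) = rd (Q u) (Q u) by rewrite Ps PQ -Qs.
      lra.
    have Ku : `|l| <= rd K u.
      rewrite /l /K /X rdotBl rdotDl ler_norml.
      by have := P0 u; have := Q0 u; move=> ? ?; apply/andP; split; lra.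
    have Kl : l * rd K u = - rd K (X u - l%:C%C *: u).
      by rewrite rdotBr KX rdotZr; lra.
    have Kn : nm K <= 2 * M.
      apply: le_trans (nmD _ _ _) _; have := PM u; have := QM u; rewrite uu; lra.
    have Xl : nm (X u - l%:C%C *: u) ^+ 2 <= N ^+ 2 - l ^+ 2.
      rewrite nmB_sqr nmZ_sqr rdotZr uu -/l.
      have := XNn u; rewrite uu => h.
      have : nm (X u) ^+ 2 <= N ^+ 2 by rewrite ler_pXn2r ?nnegrE ?nm_ge0//; lra.
      lra.
    have h1 : l ^+ 2 <= 2 * M * nm (X u - l%:C%C *: u).
      apply: le_trans (_ : `|l * rd K u| <= _).
        rewrite normrM -(real_normK (num_real l)) expr2; apply: ler_wpM2l => //.
        by apply: le_trans Ku _; apply: ler_norm.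
      rewrite Kl normrN; apply: le_trans (rdot_norm_le _ _ _) _.
      by apply: ler_wpM2r; rewrite ?nm_ge0.
    have -> : l ^+ 4 = (l ^+ 2) ^+ 2 by rewrite -exprM.
    apply: le_trans (_ : (2 * M * nm (X u - l%:C%C *: u)) ^+ 2 <= _).
      by rewrite ler_pXn2r ?nnegrE ?sqr_ge0// !mulr_ge0 ?nm_ge0.
    rewrite exprMn; have -> : (2 * M) ^+ 2 = 4 * M ^+ 2 by ring.
    by apply: ler_wpM2l => //; rewrite mulr_ge0// sqr_ge0.
  apply/eqP; rewrite eq_le N0 andbT leNgt; apply/negP => Np.
  (* for |l| > N - e with this e, key fails: its left-hand side exceeds N^4 / 16
     and its right-hand side is at most 2 B N e <= N^4 / 32 *)
  pose B := 1 + 4 * M ^+ 2.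
  have B1 : 1 <= B by rewrite /B; have := sqr_ge0 M; lra.
  pose e := Num.min (N / 2) (N ^+ 3 / (64 * B)).
  have e0 : 0 < e by rewrite lt_min divr_gt0//= divr_gt0 ?exprn_gt0// mulr_gt0//; lra.
  have [_ [u uu <-] lu] := sup_adherent e0 DS.
  have := key u uu; set l := rd (X u) u; rewrite -/N in lu.
  have lN := DN u uu.
  have e1 : e <= N / 2 by rewrite ge_min lexx.
  have e2 : e * (64 * B) <= N ^+ 3 by rewrite -ler_pdivlMr ?ge_min ?lexx ?orbT//; lra.
  have -> : l ^+ 4 = `|l| ^+ 4.
    by rewrite -normrX ger0_norm// (_ : l ^+ 4 = (l ^+ 2) ^+ 2) ?sqr_ge0// -exprM.
  rewrite -(real_normK (num_real l)); move: lu lN; rewrite -/l; set r := `|l| => lu lN.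
  apply/negP; rewrite -ltNge.
  have r2 : N / 2 < r by lra.
  have r4 : N ^+ 4 / 16 < r ^+ 4.
    have -> : N ^+ 4 / 16 = (N / 2) ^+ 4 by field.
    by rewrite ltr_pXn2r ?nnegrE//; lra.
  apply: le_lt_trans r4.
  have h : N ^+ 2 - r ^+ 2 <= 2 * N * e.
    have -> : N ^+ 2 - r ^+ 2 = (N - r) * (N + r) by ring.
    rewrite mulrC; apply: ler_pM; lra.
  apply: le_trans (_ : B * (2 * N * e) <= _).
    apply: ler_pM => //; rewrite ?mulr_ge0 ?sqr_ge0//.
      have -> : N ^+ 2 - r ^+ 2 = (N - r) * (N + r) by ring.
      by rewrite mulr_ge0//; lra.
    by rewrite /B; lra.
  have -> : B * (2 * N * e) = N * (e * (64 * B)) / 32 by field.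
  have -> : N ^+ 4 / 16 = N * N ^+ 3 / 16 by rewrite -exprS.
  have : N * (e * (64 * B)) <= N * N ^+ 3 by apply: ler_wpM2l.
  have : 0 <= N * N ^+ 3 by rewrite mulr_ge0// exprn_ge0.
  lra.
by have := XNn x; rewrite NE mul0r.
Qed.

End SquareRootUniqueness.

(** * Square roots and commuting involutions *)

Section Involution.
Context {R : realType} {H : completeNormedModType R[i]}.
Context {dot : {dot H for Num.conj}} (Hdot : induces_norm dot).
Local Notation rd := (rdot dot).
Local Notation nm := (nm dot).
Implicit Types (x y z : H) (t : R) (c : R[i]) (K : set H) (S T : operator H).

Section Basics.
Context {J : {linear H -> H}} (JP : selfadjoint_involution dot J).

Lemma invol_sym x y : dot (J x) y = dot x (J y).
Proof. by case: JP. Qed.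

Lemma invol_rsym x y : rd (J x) y = rd x (J y).
Proof. by rewrite /rdot invol_sym. Qed.

Lemma involK x : J (J x) = x.
Proof. by case: JP. Qed.

Lemma invol_nm x : nm (J x) = nm x.
Proof.
by apply/eqP; rewrite -(@eqrXn2 _ 2) ?nm_ge0// !nm_sqr invol_rsym involK.
Qed.

End Basics.

(** Let G = (I + T)^{-1}, which commutes with J.  The operator P = S G is bounded
and nonnegative with P^2 = T G^2, and J P J has the same square, so P = J P J by
[bounded_sqrt_unique].  This says that S J = J S on Dom(T), which is a core. *)
Lemma sqrt_commutes T S (J : {linear H -> H}) :
  is_sqrt dot T S -> resolvents setT T -> linear_op T ->
  selfadjoint_involution dot J -> commutes J T ->
  forall x, dom S x -> dom S (J x) /\ S (J x) = J (S x).
Proof.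
move=> h hR TL JP JT.
have [hS S0 _] := h; have SL := sa_linear hS; have SS := op_subspace SL.
have TS := op_subspace TL.
have clT : nm_closed dot [set: H] by [].
have Scl := sa_closed clT hS.
have core := sqrt_core Hdot h hR.
have Tsub : dom T `<=` dom S by move=> x; exact: (sqrt_sub h).
have JS x : dom S x -> dom S (J x) /\ nm (S (J x)) ^+ 2 <= 1 * nm (S x) ^+ 2 + 0 * nm x ^+ 2.
  apply: (form_domain_transfer Hdot (k := 1) core SL Scl SL TS Tsub).
  - by move=> u w; rewrite raddfB.
  - by move=> u; rewrite (invol_nm JP) mul1r.
  move=> u Tu; have [TJu JTu] := JT u Tu; split; first exact: Tsub.
  by rewrite (sqrt_nm h TJu) (sqrt_nm h Tu) -JTu (invol_rsym JP) (involK JP); lra.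
have inj u w : dom T u -> dom T w -> u + T u = w + T w -> u = w.
  move=> Tu Tw uw; apply/eqP; rewrite -subr_eq0; apply/eqP/(@nm_eq0 _ _ dot)/eqP.
  rewrite eq_le nm_ge0 andbT.
  have := sqrt_resolvent_contraction h ltr01 (subspaceB TS Tu Tw).
  by rewrite rmorph1 scale1r opB// addrACA -opprD uw subrr nm0.
(* G w is the solution of x + T x = w *)
have /choice[G GP] : forall w : H, exists x, dom T x /\ x + T x = w.
  move=> w; have [//|//|x Tx xE] := hR 1 _ w; exists x.
  by rewrite -xE rmorph1 scale1r.
have TG w : dom T (G w) := (GP w).1.
have SG w : dom S (G w) := Tsub _ (TG w).
have SSG w : dom S (S (G w)) := ((sqrt_dom _ h).1 (TG w)).2.
have GE w : G w + T (G w) = w := (GP w).2.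
have GE' w : w = G w + S (S (G w)) by rewrite -(sqrtE h (TG w)) GE.
have GJ w : G (J w) = J (G w).
  have [TJ TJE] := JT _ (TG w).
  by apply: inj => //; rewrite GE -TJE -raddfD GE.
have GS w : dom S w -> G (S w) = S (G w).
  move=> Sw; have [] := sqrt_resolvent_commutes h ltr01 (TG w) Sw.
    by rewrite rmorph1 scale1r.
  by rewrite rmorph1 scale1r => TSG E; apply: inj => //; rewrite GE.
have GL c u w : G (c *: u + w) = c *: G u + G w.
  apply: inj => //; first by apply: TS.2.
  by rewrite GE TL.2// addrACA -scalerDr !GE.
have GD u w : G (u + w) = G u + G w by rewrite -[u]scale1r GL !scale1r.
have G0 : G 0 = 0 by apply: (addrI (G 0)); rewrite addr0 -GD addr0.
have GZ c u : G (c *: u) = c *: G u by rewrite -[c *: u]addr0 GL G0 addr0.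
pose P u := S (G u).
have PB : bounded_nonneg (dot := dot) P 1.
  split.
  - by move=> u w; rewrite /P GD opD.
  - by move=> t u; rewrite /P GZ opZ.
  - move=> u w; rewrite /P.
    have -> : rd (S (G u)) w = rd (S (G u)) (G w) + rd (S (G u)) (S (S (G w))).
      by rewrite -rdotDr -GE'.
    have -> : rd u (S (G w)) = rd (G u) (S (G w)) + rd (S (S (G u))) (S (G w)).
      by rewrite -rdotDl -GE'.
    by rewrite (sa_rsym hS (SG u) (SG w)) (sa_rsym hS (SSG u) (SSG w)).
  - move=> u; rewrite /P.
    have -> : rd (S (G u)) u = rd (S (G u)) (G u) + rd (S (S (G u))) (S (G u)).
      by rewrite [rd (S (S _)) _]rdotC -rdotDr -GE'.
    by rewrite addr_ge0//; exact: (nonneg_rdot S0).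
  move=> u; rewrite mul1r -(@ler_pXn2r _ 2) ?nnegrE ?nm_ge0//.
  have -> : nm u ^+ 2 = nm (G u) ^+ 2 + 2 * nm (S (G u)) ^+ 2 + nm (S (S (G u))) ^+ 2.
    by rewrite [nm (S (G u)) ^+ 2]nm_sqr (sa_rsym hS (SG u) (SSG u)) -nmD_sqr -GE'.
  rewrite /P; have := sqr_ge0 (nm (G u)); have := sqr_ge0 (nm (S (S (G u)))).
  by have := sqr_ge0 (nm (S (G u))); lra.
pose Q u := J (P (J u)).
have QB : bounded_nonneg (dot := dot) Q 1.
  case: PB => PD PZ Ps P0 PM; split.
  - by move=> u w; rewrite /Q !raddfD PD raddfD.
  - by move=> t u; rewrite /Q linearZ PZ linearZ.
  - by move=> u w; rewrite /Q (invol_rsym JP) Ps (invol_rsym JP).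
  - by move=> u; rewrite /Q (invol_rsym JP).
  by move=> u; rewrite /Q (invol_nm JP); apply: le_trans (PM _) _; rewrite (invol_nm JP).
have PP u : P (P u) = T (G (G u)).
  by rewrite /P GS// (sqrtE h).
have PQ u : P u = Q u.
  apply: (bounded_sqrt_unique PB QB) => {}u.
  rewrite /Q (involK JP) !PP !GJ; have [_ <-] := JT _ (TG (G u)).
  by rewrite (involK JP).
have comT y : dom T y -> S (J y) = J (S y).
  move=> Ty; have -> : y = G (y + T y) by apply: inj => //; rewrite GE.
  by rewrite -GJ -/(P _) PQ /Q (involK JP).
move=> x Sx; have [SJx _] := JS x Sx; split=> //.
apply/eqP; rewrite -subr_eq0; apply/eqP/(@nm_eq0 _ _ dot)/eqP.
rewrite eq_le nm_ge0 andbT; apply: (@le_eps0 _ _ 2) => e e0.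
have [y Ty [xy Sxy]] := core x e Sx e0.
have Sy := Tsub _ Ty.
have Sd : dom S (x - y) by apply: subspaceB.
have -> : S (J x) - J (S x) = S (J (x - y)) - J (S (x - y)).
  rewrite raddfB (opB SL (JS _ Sx).1 (JS _ Sy).1) (opB SL Sx Sy) raddfB (comT _ Ty).
  by rewrite opprB addrA subrK.
apply: le_trans (nmD _ _ _) _; rewrite nmN (invol_nm JP).
have [_] := JS _ Sd; rewrite mul1r mul0r addr0 ler_pXn2r ?nnegrE ?nm_ge0//.
by rewrite opB//; lra.
Qed.

(** The identity between the forms is clear on Dom(T), which is a core for both
square roots; it is transferred as two inequalities, one in each direction. *)
Lemma sqrt_addI T S S1 : selfadjoint dot T -> nonneg_op dot T ->
  is_sqrt dot T S -> is_sqrt dot (op_addI T) S1 ->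
  dom S1 = dom S /\
  forall x, dom S x -> nm (S1 x) ^+ 2 = nm (S x) ^+ 2 + nm x ^+ 2.
Proof.
move=> Tsa T0 h h1; have TL := sa_linear Tsa; have TS := op_subspace TL.
have sT : linear_subspace [set: H] by [].
have clT : nm_closed dot [set: H] by [].
have hR := nonneg_resolvents Hdot sT clT Tsa T0.
have hR1 : resolvents setT (op_addI T).
  move=> e e0 w _; have e1 : 0 < 1 + e by rewrite addr_gt0.
  have [|x Tx xw] := hR (e / (1 + e)) _ ((1 + e)^-1%:C%C *: w) I.
    by rewrite divr_gt0.
  exists x => //=; rewrite scalerDr (addrC (_ *: T x)) addrA.
  have -> : w = (1 + e)%:C%C *: (x + (e / (1 + e))%:C%C *: T x).
    by rewrite xw scalerA -rmorphM divff ?gt_eqF// scale1r.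
  rewrite scalerDr scalerA -rmorphM mulrCA divff ?gt_eqF// mulr1.
  by rewrite rmorphD rmorph1 scalerDl scale1r.
have core := sqrt_core Hdot h hR; have core1 := sqrt_core Hdot h1 hR1.
have [hS _ _] := h; have [hS1 _ _] := h1.
have SL := sa_linear hS; have S1L := sa_linear hS1.
have Scl := sa_closed clT hS; have S1cl := sa_closed clT hS1.
have nmT x : dom T x -> nm (S1 x) ^+ 2 = nm (S x) ^+ 2 + nm x ^+ 2.
  by move=> Tx; rewrite (sqrt_nm h1 Tx) (sqrt_nm h Tx)/= rdotDl -nm_sqr.
have t1 x : dom S x -> dom S1 x /\ nm (S1 x) ^+ 2 <= 1 * nm (S x) ^+ 2 + 1 * nm x ^+ 2.
  apply: (form_domain_transfer Hdot (p := id) (k := 1) core S1L S1cl SL TS) => //.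
  - by move=> y; exact: (sqrt_sub h).
  - by move=> y; rewrite mul1r.
  by move=> y Ty; rewrite (nmT _ Ty) !mul1r; split=> //; exact: (sqrt_sub h1).
have t2 x : dom S1 x -> dom S x /\ nm (S x) ^+ 2 <= 1 * nm (S1 x) ^+ 2 + (-1) * nm x ^+ 2.
  apply: (form_domain_transfer Hdot (p := id) (k := 1) core1 SL Scl S1L TS) => //.
  - by move=> y; exact: (sqrt_sub h1).
  - by move=> y; rewrite mul1r.
  move=> y Ty; rewrite (nmT _ Ty); split; last lra.
  exact: (sqrt_sub h).
split; first by apply/seteqP; split=> x; [move/t2 => []|move/t1 => []].
move=> x Sx; have [S1x le1] := t1 x Sx; have [_ le2] := t2 x S1x.
by apply/eqP; rewrite eq_le; apply/andP; split; lra.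
Qed.

End Involution.

(** * Operators associated with twisted-coercive forms *)

Section FormOperator.
Context {R : realType} {H : completeNormedModType R[i]}.
Context {dot : {dot H for Num.conj}} (Hdot : induces_norm dot).
Local Notation rd := (rdot dot).
Local Notation nm := (nm dot).
Implicit Types (x y z : H) (t : R) (c : R[i]) (K : set H) (S T : operator H).

Let clT : nm_closed dot [set: H]. Proof. by []. Qed.
Let subT : linear_subspace [set: H]. Proof. by []. Qed.

(** Used to see that such an operator is closed. *)
Lemma everywhere_symmetric_sa (F : H -> H) :
  (forall c x y, F (c *: x + y) = c *: F x + F y) ->
  (forall x y, dot (F x) y = dot x (F y)) -> selfadjoint dot (Operator setT F).
Proof.
move=> FL Fs; split=> //; first exact: subset_closure.
apply/seteqP; split=> [[x y] [/= _ _ h]|[x y] [/= _ <-]].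
  split=> //=; apply: (@eq_dotr _ _ dot) => z.
  by rewrite /rdot -h// Fs.
by split=> //= z _; rewrite Fs.
Qed.

Lemma sa_inverse S : selfadjoint dot S -> (forall x, dom S x -> nm x <= nm (S x)) ->
  exists G : H -> H,
    [/\ forall p, dom S (G p), forall p, S (G p) = p,
        forall x, dom S x -> G (S x) = x,
        forall c p q, G (c *: p + q) = c *: G p + G q &
        forall p q, dot (G p) q = dot p (G q)].
Proof.
move=> Ssa S1; have SL := sa_linear Ssa; have SS := op_subspace SL.
have inj x y : dom S x -> dom S y -> S x = S y -> x = y.
  move=> Sx Sy xy; apply/eqP; rewrite -subr_eq0; apply/eqP/(@nm_eq0 _ _ dot)/eqP.
  rewrite eq_le nm_ge0 andbT.
  by have := S1 _ (subspaceB SS Sx Sy); rewrite opB// xy subrr nm0.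
have /choice[G GP] : forall p, exists x, dom S x /\ S x = p.
  move=> p.
  have [||||x Sx Sxp] :=
    @surjective_of_bound _ _ _ Hdot setT S 1 subT SL _ _ ltr01 _ _ p I.
  - exact: sa_closed clT Ssa.
  - by [].
  - by move=> x Sx; rewrite mul1r; exact: S1.
  - move=> w _ h.
    have [//|//|x Sx|Sw Sw0] := @sa_max _ _ _ _ _ Ssa w 0; first by rewrite h// dot0r.
    by apply: inj => //; [exact: SS.1|rewrite Sw0 op0].
  by exists x.
have SG p := (GP p).1; have GE p := (GP p).2.
exists G; split=> //.
- by move=> x Sx; apply: inj.
- move=> c p q; apply: inj => //; first by apply: SS.2.
  by rewrite SL.2// !GE.
by move=> p q; rewrite -{1}(GE q) -{2}(GE p) (sa_sym Ssa).
Qed.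

(** In terms of p = S x and q = S y this is [symmetric_form_bound]. *)
Lemma form_bound S (f : dform H) (M : R) :
  selfadjoint dot S -> (forall x, dom S x -> nm x <= nm (S x)) ->
  fdom f = dom S -> sesquilinear_dform f -> symmetric_dform f ->
  (forall x, fdom f x -> `|complex.Re (f x x)| <= M * nm (S x) ^+ 2) ->
  forall x y, fdom f x -> fdom f y ->
    complex.Re (f x y) <= M * nm (S x) * nm (S y).
Proof.
move=> Ssa S1 fS [_ fl fr] fsym fM x y.
have [G [SG GE GK GL _]] := sa_inverse Ssa S1.
have SS := op_subspace (sa_linear Ssa).
rewrite fS in fl fr fM * => Sx Sy.
have f0 z : dom S z -> f 0 z = 0.
  move=> Sz; have := fl 1 0 0 z SS.1 SS.1 Sz; rewrite scaler0 addr0 mul1r => h.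
  by apply: (addrI (f 0 z)); rewrite addr0.
pose g p q := complex.Re (f (G p) (G q)).
suff gM : g (S x) (S y) <= M * nm (S x) * nm (S y) by move: gM; rewrite /g !GK.
apply: (@symmetric_form_bound _ _ dot setT) => //.
- by move=> u w z _ _ _; rewrite /g -[u in G (u + _)]scale1r GL fl// mul1r raddfD.
- move=> t u w _ _; have G0 : G 0 = 0.
    by rewrite -{1}(op0 (sa_linear Ssa)) GK//; exact: SS.1.
  by rewrite /g -[_ *: u]addr0 GL fl// G0 ?f0 ?addr0 ?ReZ//; exact: SS.1.
- by move=> u w _ _; rewrite /g fsym ?fS//; case: (f _ _).
by move=> u _; rewrite /g -{3}(GE u); exact: fM.
Qed.

(** The form need not be coercive; it becomes so when U is applied to its first
argument, and U does not increase the norm |S .|. *)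
Definition twisted_coercive S (f : dform H) (U : H -> H) (M : R) : Prop :=
  [/\ forall x, fdom f x -> `|complex.Re (f x x)| <= M * nm (S x) ^+ 2,
      forall x, fdom f x -> dom S (U x) /\ nm (S (U x)) <= nm (S x) &
      forall x, fdom f x -> nm (S x) ^+ 2 <= complex.Re (f (U x) x)].

(** With G the inverse of S, the form f (G p) (G q) is <p, F q> for a symmetric F,
and |F q| >= |q| by twisted coercivity; so F is a bijection.  A solution of
f (., y) = <., h> is y = G F^{-1} G h.  As G h ranges over the dense set Dom(S),
the vectors S y = F^{-1} (G h) are dense, which is the second part. *)
Lemma lax_milgram S (f : dform H) (U : H -> H) (M : R) :
  selfadjoint dot S -> (forall x, dom S x -> nm x <= nm (S x)) ->
  fdom f = dom S -> sesquilinear_dform f -> symmetric_dform f ->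
  twisted_coercive S f U M ->
  (forall h, exists2 y, dom S y & forall x, dom S x -> f x y = dot x h) /\
  (forall y (e : R), dom S y -> 0 < e ->
     exists z h, [/\ dom S z, forall x, dom S x -> f x z = dot x h &
                     nm (S (y - z)) < e]).
Proof.
move=> Ssa S1 fS fsesq fsym [fM fU fco].
have [G [SG GE GK GL Gs]] := sa_inverse Ssa S1.
have SL := sa_linear Ssa; have SS := op_subspace SL.
case: (fsesq) => _; rewrite fS => fl fr.
pose g p q := complex.Re (f (G p) (G q)).
have GD p q : G (p + q) = G p + G q by rewrite -[p]scale1r GL !scale1r.
have G0 : G 0 = 0 by apply: (addrI (G 0)); rewrite addr0 -GD addr0.
have GZ c p : G (c *: p) = c *: G p by rewrite -[c *: p]addr0 GL G0 addr0.
have f0l z : dom S z -> f 0 z = 0.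
  move=> Sz; have := fl 1 0 0 z SS.1 SS.1 Sz; rewrite scaler0 addr0 mul1r => h.
  by apply: (addrI (f 0 z)); rewrite addr0.
have fD x y z : dom S x -> dom S y -> dom S z -> f (x + y) z = f x z + f y z.
  by move=> Sx Sy Sz; rewrite -[x in LHS]scale1r fl// mul1r.
have fZ c x z : dom S x -> dom S z -> f (c *: x) z = c * f x z.
  by move=> Sx Sz; rewrite -[c *: x]addr0 fl ?f0l ?addr0//; exact: SS.1.
have fC p q : f (G p) (G q) = (f (G q) (G p))^* by apply: fsym; rewrite fS.
have gM p q : g p q <= M * nm q * nm p.
  rewrite mulrAC -{2}(GE p) -{2}(GE q).
  by apply: (form_bound Ssa S1 fS fsesq fsym fM); rewrite fS.
have /choice[F FP] : forall q, exists w, forall p, f (G p) (G q) = dot p w.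
  move=> q; apply: (riesz Hdot (M := M * nm q)) => [c u w|p]; last exact: gM.
  by rewrite GL fl.
have eqd u w : (forall p, dot p u = dot p w) -> u = w.
  by move=> h; apply: (@eq_dotr _ _ dot) => z; rewrite /rdot h.
have FL c u w : F (c *: u + w) = c *: F u + F w.
  by apply: eqd => p; rewrite -FP GL fr// dotDr dotZr -!FP.
have Fs p q : dot (F p) q = dot p (F q).
  by rewrite dotC -FP fC FP conjCK.
have Fco q : nm q <= nm (F q).
  have [SU UU] : dom S (U (G q)) /\ nm (S (U (G q))) <= nm q.
    by have := fU (G q); rewrite fS GE; apply.
  have := fco (G q); rewrite fS GE => /(_ (SG q)).
  rewrite -{1}(GK _ SU) FP -/(rdot dot _ _) => h.
  have := rdot_le dot (S (U (G q))) (F q).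
  have n0 := nm_ge0 dot q; have n1 := nm_ge0 dot (F q).
  have [->//|q0] := eqVneq (nm q) 0.
  have pq : 0 < nm q by rewrite lt_def q0.
  move=> h2; rewrite -(ler_pM2l pq) -expr2; apply: le_trans h _; apply: le_trans h2 _.
  exact: ler_wpM2r.
pose Fop : operator H := Operator setT F.
have FopL : linear_op Fop by split.
have FD u w : F (u + w) = F u + F w by rewrite -[u]scale1r FL !scale1r.
have F0 : F 0 = 0 := op0 FopL.
have FN u : F (- u) = - F u.
  by apply/eqP; rewrite -addr_eq0 -FD addNr F0.
have Fsur h : exists q, F q = h.
  have [||||q _ Fq] := @surjective_of_bound _ _ _ Hdot setT Fop 1 subT FopL _ _ ltr01 _ _ h I.
  - exact: (sa_closed clT (everywhere_symmetric_sa FL Fs)).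
  - by [].
  - by move=> x _; rewrite mul1r.
  - move=> w _ /= hw; apply: (@nm_eq0 _ _ dot); apply/eqP; rewrite eq_le nm_ge0 andbT.
    have -> : 0 = nm (F w) :> R.
      rewrite (_ : F w = 0) ?nm0//; apply: eqd => p; rewrite dot0r -Fs; exact: hw.
    exact: Fco.
  by exists q.
split=> [h|y e Sy e0].
  have [q Fq] := Fsur (G h); exists (G q) => // x Sx.
  by rewrite -{1}(GK _ Sx) FP Fq -Gs GK.
have [d Sd dE] := sa_dense Hdot Ssa I e0 : exists2 d, dom S d & nm (F (S y) - d) < e.
have [q Fq] := Fsur d; exists (G q), (S d); split=> // [x Sx|].
  by rewrite -{1}(GK _ Sx) FP Fq -{1}(GK _ Sd) -Gs GK.
rewrite opB// GE; apply: le_lt_trans (Fco _) _.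
by rewrite FD FN Fq.
Qed.

(** A closed graph theorem.  With G the inverse of S, the vectors G C z, for z in
Dom(C) of norm at most 1, are weakly bounded because
<p, G C z> = <C G p, z>; so they are bounded by some M, and
|C y| = sup |<C y, z>| = sup |<S y, G C z>| <= M |S y|. *)
Lemma symmetric_relatively_bounded S C :
  selfadjoint dot S -> (forall x, dom S x -> nm x <= nm (S x)) ->
  linear_op C -> (forall x y, dom C x -> dom C y -> rd (C x) y = rd x (C y)) ->
  dom S `<=` dom C ->
  exists K : R, forall y, dom S y -> nm (C y) <= K * nm (S y).
Proof.
move=> Ssa S1 CL Cs SC; have [G [SG GE GK _ Gs]] := sa_inverse Ssa S1.
have Grs p q : rd (G p) q = rd p (G q) by rewrite /rdot Gs.
have Cdense x (e : R) : 0 < e -> exists2 y, dom C y & nm (x - y) < e.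
  by move=> e0; have [y /SC Cy xy] := sa_dense Hdot Ssa (I : setT x) e0; exists y.
pose W := [set w | exists2 z, dom C z /\ nm z <= 1 & w = G (C z)].
have [p|M MW] := @weakly_bounded _ _ _ Hdot W.
  exists (nm (C (G p))) => _ [z [Cz z1] ->].
  rewrite -Grs -Cs//; last by apply: SC.
  apply: le_trans (rdot_norm_le _ _ _) _; rewrite -[leRHS]mulr1.
  by apply: ler_wpM2l => //; exact: nm_ge0.
exists `|M| => y Sy; have Cy := SC _ Sy.
have bnd z : dom C z -> rd (C y) z <= `|M| * nm (S y) * nm z.
  move=> Cz; have [/nm_eq0 ->|z0] := eqVneq (nm z) 0.
    by rewrite rdot0r nm0 mulr0.
  have pz : 0 < nm z by rewrite lt_def z0 nm_ge0.
  pose w := (nm z)^-1%:C%C *: z.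
  have Cw : dom C w by apply: subspaceZ => //; exact: op_subspace.
  have zw : z = (nm z)%:C%C *: w by rewrite scalerA -rmorphM divff// scale1r.
  have w1 : nm w <= 1 by rewrite nmZ gtr0_norm ?invr_gt0// mulVf.
  rewrite {1}zw rdotZr mulrC; apply: ler_wpM2r; first exact: nm_ge0.
  rewrite Cs// -{1}(GK _ Sy) Grs; apply: le_trans (rdot_le _ _ _) _.
  rewrite mulrC; apply: ler_wpM2r; first exact: nm_ge0.
  by apply: le_trans (ler_norm _); apply: MW; exists w.
have [Cy0|Cy0] := eqVneq (nm (C y)) 0.
  by rewrite Cy0 mulr_ge0 ?nm_ge0.
have pC : 0 < nm (C y) by rewrite lt_def Cy0 nm_ge0.
rewrite -(ler_pM2r pC) -expr2 -subr_le0.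
apply: (@le_eps0 _ _ (nm (C y) + `|M| * nm (S y))) => e e0.
have [z Cz yz] := Cdense (C y) e e0.
have h1 := bnd z Cz; have h2 := rdot_le dot (C y) (C y - z).
have h3 := nm_le_add dot z (C y); rewrite nmBC in h3.
have h4 : 0 <= `|M| * nm (S y) by rewrite mulr_ge0 ?nm_ge0.
have h5 : nm (C y) ^+ 2 = rd (C y) z + rd (C y) (C y - z).
  by rewrite -rdotDr addrC subrK nm_sqr.
rewrite h5; nra.
Qed.

(** The largest operator associated with b, as a relation: it is a function when
Dom[b] is dense. *)
Definition form_graph (b : dform H) y h : Prop :=
  fdom b y /\ forall x, fdom b x -> b x y = dot x h.

(** The symmetric operator B with this graph is such that B + J is onto.  Hence B is
self-adjoint: if <Bx, p> = <x, q> for all x in Dom(B), choose y in Dom(B) with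
(B + J) y = q + J p; then <(B + J) x, p - y> = 0 for all x, so p = y. *)
Lemma associated_operator (b : dform H) (J : {linear H -> H}) :
  sesquilinear_dform b -> symmetric_dform b -> selfadjoint_involution dot J ->
  (forall x (e : R), 0 < e -> exists2 y, fdom b y & nm (x - y) < e) ->
  (forall y (e : R), fdom b y -> 0 < e ->
     exists z h, form_graph b z h /\ nm (y - z) < e) ->
  (forall h, exists2 y, fdom b y & forall x, fdom b x -> b x y + dot x (J y) = dot x h) ->
  exists B : operator H,
    [/\ selfadjoint dot B, associated dot b B,
        forall B' : operator H,
          selfadjoint dot B' -> associated dot b B' -> graph B' = graph B &
        forall y h, form_graph b y h <-> dom B y /\ B y = h].
Proof.
move=> [bS bl br] bsym JP bdense bcore bsur.
have uniq y h h' : form_graph b y h -> form_graph b y h' -> h = h'.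
  move=> [_ h1] [_ h2]; apply/eqP; rewrite -subr_eq0; apply/eqP/(@nm_eq0 _ _ dot)/eqP.
  rewrite -sqrf_eq0 eq_le sqr_ge0 andbT.
  apply: (@le_eps0 _ _ (nm (h - h'))) => e e0.
  have [x bx hx] := bdense (h - h') e e0.
  have xh : rd x (h - h') = 0 by rewrite rdotBr /rdot -h1// -h2// subrr.
  rewrite nm_sqr -[rd _ _]subr0 -xh -rdotBl; apply: le_trans (rdot_le _ _ _) _.
  by apply: ler_wpM2r; [exact: nm_ge0|exact: ltW].
have /choice[Bf BfP] : forall y, exists h, (exists h', form_graph b y h') -> form_graph b y h.
  move=> y; have [[h hP]|n] := pselect (exists h', form_graph b y h').
    by exists h.
  by exists 0.
pose B : operator H := Operator [set y | exists h, form_graph b y h] Bf.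
have BP y h : form_graph b y h <-> dom B y /\ B y = h.
  split=> [yh|[/BfP + <-]//]; split; first by exists h.
  exact: uniq (BfP y (ex_intro _ h yh)) yh.
have Bb y : dom B y -> fdom b y by move=> [h []].
have BE x y : fdom b x -> dom B y -> b x y = dot x (B y).
  by move=> bx By; have [_] := (BP y _).2 (conj By erefl); apply.
have Bsym x y : dom B x -> dom B y -> dot (B x) y = dot x (B y).
  move=> Bx By; rewrite -(BE x y (Bb _ Bx) By) dotC -(BE y x (Bb _ By) Bx).
  by rewrite (bsym _ _ (Bb _ By) (Bb _ Bx)) conjCK.
have Bmax B' x : associated dot b B' -> dom B' x -> dom B x /\ B x = B' x.
  by move=> [B'b B'E] B'x; apply/BP; split=> [|y By]; [exact: B'b|exact: B'E].
have BL : linear_op B.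
  have lin c x y : dom B x -> dom B y -> form_graph b (c *: x + y) (c *: B x + B y).
    move=> Bx By; split; first by apply: bS.2; exact: Bb.
    move=> z bz; rewrite br//; try exact: Bb.
    by rewrite !BE// dotDr dotZr.
  split=> [|c x y Bx By]; last by have /BP[] := lin c x y Bx By.
  split; last by move=> c x y Bx By; have /BP[] := lin c x y Bx By.
  exists 0; split=> [|x bx]; first exact: bS.1.
  have := br 1 0 0 x bS.1 bS.1 bx; rewrite scaler0 addr0 conjC1 mul1r => h.
  by apply: (addrI (b x 0)); rewrite dot0r addr0.
have Bsur h : exists2 y, dom B y & B y + J y = h.
  have [y by_ yP] := bsur h.
  have /BP[By BE'] : form_graph b y (h - J y).
    by split=> // x bx; rewrite dotBr -yP// addrK.
  by exists y => //; rewrite BE' subrK.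
have Bsa : selfadjoint dot B.
  split=> //.
    move=> x _; apply/(closure_nm Hdot) => e e0.
    have e2 : 0 < e / 2 by rewrite divr_gt0.
    have [y by_ xy] := bdense x _ e2; have [z [h [/BP[Bz _] yz]]] := bcore y _ by_ e2.
    by exists z => //; have := nmB_trans dot x y z; lra.
  apply/seteqP; split=> [[p q] [/= _ _ h]|[x y] [/= Bx <-]]; last first.
    by split=> //= z Bz; exact: Bsym.
  have [y By yE] := Bsur (q + J p).
  suff py : p = y by subst y; split=> //=; apply: (addIr (J p)); rewrite yE.
  apply: (@eq_dotr _ _ dot) => w; have [x Bx <-] := Bsur w.
  rewrite /rdot !dotDl h// (Bsym _ _ Bx By) !(invol_sym JP) -!dotDr yE.
  by rewrite addrC.
have Bas : associated dot b B by split=> [y|x y bx By]; [exact: Bb|exact: BE].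
exists B; split=> // B' B'sa B'as; apply/seteqP; split=> [[x y] [/= B'x <-]|[x y] [/= Bx <-]].
  exact: (Bmax B' x B'as B'x).
apply: (sa_max B'sa) => // z B'z.
by have [Bz <-] := Bmax _ _ B'as B'z; exact: Bsym.
Qed.

End FormOperator.

Arguments twisted_coercive {R H} dot S f U M.
Arguments form_graph {R H} dot b y h.

(** * Integrals with respect to a projection-valued measure *)

Section Pvm.
Context {R : realType} {H : completeNormedModType R[i]}.
Context {dot : {dot H for Num.conj}}.
Local Notation rd := (rdot dot).
Local Notation nm := (nm dot).
Context {E : pvm dot}.
Implicit Types (x y z : H) (T : operator H) (M N : set (measurableTypeR R)).
Local Notation mu := (spectral_dist E).

Lemma pvmD M x y : E M (x + y) = E M x + E M y.
Proof. exact: raddfD. Qed.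

Lemma pvmB M x y : E M (x - y) = E M x - E M y.
Proof. exact: raddfB. Qed.

Lemma pvmZ M (c : R[i]) x : E M (c *: x) = c *: E M x.
Proof. exact: linearZ. Qed.

Lemma pvm_rsym M x y : rd (E M x) y = rd x (E M y).
Proof. by rewrite /rdot proj_sym. Qed.

Lemma pvm_rdot M x : rd (E M x) x = nm (E M x) ^+ 2.
Proof. by rewrite nm_sqr pvm_rsym -{1}[E M x]proj_idem pvm_rsym. Qed.

Lemma spectral_distE M x : mu x M = (nm (E M x) ^+ 2)%:E.
Proof. by rewrite -pvm_rdot. Qed.

Lemma pvm_orth M N x y : measurable M -> measurable N -> M `&` N = set0 ->
  rd (E M x) (E N y) = 0.
Proof. by move=> mM mN MN; rewrite pvm_rsym -projI// MN proj0 rdot0r. Qed.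

Lemma pvm_sub M N x : measurable M -> measurable N -> M `<=` N ->
  E N (E M x) = E M x.
Proof. by move=> mM mN MN; rewrite -projI// setIC (setIidl MN). Qed.

(** The square of |E(M u N) x - E(M) x - E(N) x| expands to 0, because the measure
<E(.)x, x> is additive and the ranges of E(M) and E(N) are orthogonal. *)
Lemma pvmU M N x : measurable M -> measurable N -> M `&` N = set0 ->
  E (M `|` N) x = E M x + E N x.
Proof.
move=> mM mN MN.
have : (mu x (M `|` N) = mu x M + mu x N)%E by rewrite measureU//; exact/eqP.
rewrite !spectral_distE -EFinD => -[h].
apply/eqP; rewrite -subr_eq0; apply/eqP/(@nm_eq0 _ _ dot)/eqP.
rewrite -sqrf_eq0; apply/eqP; rewrite nmB_sqr h nmD_sqr rdotDr.
have mMN : measurable (M `|` N) by exact: measurableU.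
have e K : measurable K -> K `<=` M `|` N -> rd (E (M `|` N) x) (E K x) = nm (E K x) ^+ 2.
  by move=> mK KMN; rewrite pvm_rsym pvm_sub// rdotC pvm_rdot.
rewrite (e _ mM (@subsetUl _ M N)) (e _ mN (@subsetUr _ M N)) pvm_orth//; lra.
Qed.

Lemma pvmC M x : measurable M -> E M x + E (~` M) x = x.
Proof.
move=> mM; rewrite -pvmU ?setICr ?setUv ?projT//; exact: measurableC.
Qed.

Section Integral.
Context {f : R -> R} {T : operator H} (Tf : spectral_integral E f T).
Hypothesis mf : measurable_fun [set: measurableTypeR R] (f : measurableTypeR R -> R).

Let mf2 : measurable_fun [set: measurableTypeR R]
  (fun l : measurableTypeR R => (f l ^+ 2)%:E : \bar R).
Proof. by apply/measurable_EFinP; apply: measurable_funX. Qed.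

Let f20 l : (0 <= (f l ^+ 2)%:E)%E.
Proof. by rewrite lee_fin sqr_ge0. Qed.

Lemma si_linear : linear_op T. Proof. by case: Tf. Qed.

Lemma si_dom x : dom T x = (\int[mu x]_l (f l ^+ 2)%:E < +oo)%E.
Proof. by case: Tf => _ ->. Qed.

(** The measure is finite, and |f| <= 1 + f^2. *)
Lemma si_integrable x : dom T x -> (mu x).-integrable setT (EFin \o f).
Proof.
rewrite si_dom => h; apply/integrableP; split; first exact/measurable_EFinP.
apply: le_lt_trans (_ : (\int[mu x]_l (1 + (f l ^+ 2)%:E) < +oo)%E).
  apply: ge0_le_integral => //.
  - by apply: measurableT_comp => //; exact/measurable_EFinP.
  - exact: emeasurable_funD.
  move=> l _ /=; rewrite -EFinD lee_fin.
  rewrite ler_norml; have := sqr_ge0 (f l - 1); have := sqr_ge0 (f l + 1).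
  by have := sqr_ge0 (f l); move=> ? ? ?; apply/andP; split; nra.
rewrite ge0_integralD// integral_cst// mul1e.
by apply: lte_add_pinfty => //; exact: ltry.
Qed.

Lemma si_form x : dom T x -> rd (T x) x = Rintegral (mu x) setT f.
Proof. by case: Tf => _ _ h /h; rewrite /rdot => ->. Qed.

Lemma si_real x : dom T x -> complex.Im (dot (T x) x) = 0.
Proof. by case: Tf => _ _ h /h ->. Qed.

(** A symmetric operator is one whose quadratic form is real, by polarization. *)
Lemma si_rsym x y : dom T x -> dom T y -> rd (T x) y = rd x (T y).
Proof.
have TL := si_linear; have TS := op_subspace TL.
have im u w : dom T u -> dom T w -> complex.Im (dot (T u) w) = complex.Im (dot u (T w)).
  move=> Tu Tw; have := si_real (subspaceD TS Tu Tw).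
  rewrite opD// dotDl !dotDr (dotC dot u).
  have := si_real Tu; have := si_real Tw.
  case: (dot (T u) u) (dot (T w) w) (dot (T u) w) (dot (T w) u).
  by move=> a a' [b b'] [c c'] [d d'] /= -> ->; lra.
move=> Tx Ty; have Tiy : dom T ('i%C *: y) by exact: subspaceZ.
have := im _ _ Tx Tiy; rewrite opZ// !dotZr /rdot.
by case: (dot (T x) y) => a b; case: (dot x (T y)) => a' b' /=; lra.
Qed.

(** So the quadratic form of T at x is the sum of its values at the two orthogonal
components of x: this is all that the commutation of T with E(M) rests on. *)
Lemma spectral_dist_split M x A : measurable M -> measurable A ->
  mu x A = (mu (E M x) A + mu (E (~` M) x) A)%E.
Proof.
move=> mM mA; have mC := measurableC mM.
rewrite !spectral_distE -EFinD; congr (_%:E).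
rewrite -{1}(pvmC x mM) pvmD nmD_sqr -!projI// pvm_orth. lra.
- exact: measurableI.
- exact: measurableI.
- by rewrite setIACA setICr setI0.
Qed.

Lemma si_split M x : measurable M -> dom T x ->
  [/\ dom T (E M x), dom T (E (~` M) x) &
      rd (T x) x = rd (T (E M x)) (E M x) + rd (T (E (~` M) x)) (E (~` M) x)].
Proof.
move=> mM Tx.
have addE A : measurable A -> A `<=` setT ->
    mu x A = measure_add (mu (E M x)) (mu (E (~` M) x)) A.
  by move=> mA _; rewrite measure_addE (spectral_dist_split x mM mA).
have [TM TC] : dom T (E M x) /\ dom T (E (~` M) x).
  have := Tx; rewrite !si_dom (eq_measure_integral _ addE) ge0_integral_measure_add//.
  move=> h; split; apply: le_lt_trans h; [apply: leeDl|apply: leeDr];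
  exact: integral_ge0.
split=> //; rewrite !si_form// /Rintegral (eq_measure_integral _ addE).
rewrite integral_measure_add//; [|exact: si_integrable..].
by rewrite fineD//; apply: integrable_fin_num => //; exact: si_integrable.
Qed.

(** The measure <E(.)z, z> is carried by M, where f is between c and d. *)
Lemma si_bounds M (c d : R) z : measurable M -> (forall l, M l -> c <= f l <= d) ->
  E M z = z ->
  [/\ dom T z, c * nm z ^+ 2 <= rd (T z) z & rd (T z) z <= d * nm z ^+ 2].
Proof.
move=> mM fM Mz; have mC := measurableC mM.
have muC : (mu z (~` M) = 0)%E.
  by rewrite spectral_distE -Mz -projI// setIC setICr proj0 nm0 expr0n.
have muM : (mu z M = (nm z ^+ 2)%:E)%E by rewrite spectral_distE Mz.
have intM (k : R) : (\int[mu z]_(l in M) k%:E = (k * nm z ^+ 2)%:E)%E.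
  by rewrite EFinM -muM; exact: integral_cst.
have disj : [disjoint M & ~` M] by apply/eqP; rewrite setICr.
have UT : setT = M `|` ~` M by rewrite setUv.
have Tz : dom T z.
  rewrite si_dom UT ge0_integral_setU//; last first.
    by rewrite -UT; exact: mf2.
  rewrite (null_set_integral mC) ?adde0//; last exact: measurable_funTS.
  apply: le_lt_trans (_ : (\int[mu z]_(l in M) (c ^+ 2 + d ^+ 2)%:E < +oo)%E).
    apply: ge0_le_integral => //.
    - exact: measurable_funTS.
    move=> l /fM/andP[cf fd]; rewrite lee_fin.
    have c2 := sqr_ge0 c; have d2 := sqr_ge0 d.
    by have [f0|f0] := lerP 0 (f l); nra.
  by rewrite intM ltry.
have int := si_integrable Tz.
have iM : (mu z).-integrable M (EFin \o f) by apply: integrableS int.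
have icst (k : R) : (mu z).-integrable M (EFin \o cst k).
  apply/integrableP; split; first by apply/measurable_EFinP; exact: measurable_cst.
  by have := intM `|k|; rewrite /= => ->; rewrite ltry.
have E1 : rd (T z) z = \int[mu z]_(l in M) f l.
  rewrite si_form// UT Rintegral_setU// -?UT//.
  rewrite [X in _ + X](_ : _ = 0) ?addr0// /Rintegral null_set_integral//.
  by apply/measurable_EFinP; exact: measurable_funTS.
have cstE (k : R) : \int[mu z]_(l in M) k = k * nm z ^+ 2.
  by rewrite /Rintegral intM.
split=> //; rewrite E1 -cstE; apply: le_Rintegral => //; try exact: icst.
- by move=> l /fM/andP[].
- by move=> l /fM/andP[].
Qed.

Hypothesis Tdense : forall x (e : R), 0 < e -> exists2 y, dom T y & nm (x - y) < e.

(** For u, w in Dom(T), apply [si_split] to the sum of E(N) u and of the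
complementary component of w: the cross terms <T E(N) u, w - E(N) w> must vanish.
As Dom(T) is dense, T E(N) u has no component outside the range of E(N); use this
for N = M and for N the complement of M. *)
Lemma si_commute M x : measurable M -> dom T x ->
  dom T (E M x) /\ T (E M x) = E M (T x).
Proof.
have TL := si_linear; have TS := op_subspace TL.
have key N u w : measurable N -> dom T u -> dom T w -> rd (T (E N u)) (E (~` N) w) = 0.
  move=> mN Tu Tw; have mC := measurableC mN.
  have [TNu _ _] := si_split mN Tu; have [_ TCw _] := si_split mN Tw.
  have [_ _] := si_split mN (subspaceD TS TNu TCw).
  rewrite !pvmD proj_idem -!projI// setICr proj0 addr0.
  rewrite setIC setICr proj0 add0r setIid.
  rewrite opD// rdotDl !rdotDr (si_rsym TCw TNu) (rdotC _ (E (~` N) w)).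
  by lra.
have dense0 u : (forall w, dom T w -> rd u w = 0) -> u = 0.
  move=> h; apply: (@nm_eq0 _ _ dot); apply/eqP; rewrite -sqrf_eq0 eq_le sqr_ge0 andbT.
  apply: (@le_eps0 _ _ (nm u)) => e /(Tdense u)[w Tw uw].
  rewrite nm_sqr -[rd u u]subr0 -(h w Tw) -rdotBr; apply: le_trans (rdot_le _ _ _) _.
  by rewrite mulrC; apply: ler_wpM2r; [exact: nm_ge0|exact: ltW].
have key2 N u : measurable N -> dom T u -> E (~` N) (T (E N u)) = 0.
  by move=> mN Tu; apply: dense0 => w Tw; rewrite pvm_rsym key.
move=> mM Tx; have mC := measurableC mM; have [TM TC _] := si_split mM Tx.
split=> //; have := key2 _ _ mC Tx; rewrite setCK => h2.
rewrite -{2}(pvmC x mM) opD// pvmD h2 addr0.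
by rewrite -{1}(pvmC (T (E M x)) mM) key2// addr0.
Qed.

Lemma si_range M z : measurable M -> dom T z -> E M z = z -> E M (T z) = T z.
Proof. by move=> mM Tz Mz; have [_ <-] := si_commute mM Tz; rewrite Mz. Qed.

(** T - m I is symmetric on the range of E(M), and its quadratic form is at most
e |u|^2 there; apply [numerical_radius]. *)
Lemma si_range_close M (m e : R) z : measurable M ->
  (forall l, M l -> `|f l - m| <= e) -> E M z = z ->
  nm (T z - m%:C%C *: z) <= e * nm z.
Proof.
move=> mM fm Mz; have TL := si_linear.
have dM u : E M u = u -> [/\ dom T u, (m - e) * nm u ^+ 2 <= rd (T u) u &
                             rd (T u) u <= (m + e) * nm u ^+ 2].
  move=> Mu; apply: (si_bounds mM) Mu => l /fm; rewrite ler_norml => /andP[h1 h2].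
  by apply/andP; split; lra.
apply: (@numerical_radius _ _ dot [set u | E M u = u] (fun u => T u - m%:C%C *: u)) => //=.
- by move=> u w Mu Mw; rewrite pvmD Mu Mw.
- by move=> t u Mu; rewrite pvmZ Mu.
- move=> u Mu; have [Tu _ _] := dM u Mu.
  by rewrite pvmB pvmZ (si_range mM Tu Mu) Mu.
- move=> u w /dM[Tu _ _] /dM[Tw _ _]; rewrite opD// scalerDr opprD addrACA//.
- move=> t u /dM[Tu _ _]; rewrite opZ// scalerBr; congr (_ - _).
  by rewrite !scalerA mulrC.
- move=> u w /dM[Tu _ _] /dM[Tw _ _].
  by rewrite rdotBl rdotBr rdotZl rdotZr si_rsym.
move=> u /dM[_ h1 h2]; rewrite rdotBl rdotZl -nm_sqr ler_norml.
by apply/andP; split; lra.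
Qed.

End Integral.

Lemma pvm_range_orth M N x y : measurable M -> measurable N -> M `&` N = set0 ->
  E M x = x -> E N y = y -> rd x y = 0.
Proof. by move=> mM mN MN <- <-; exact: pvm_orth. Qed.

Lemma pvm_range_sub M N x : measurable M -> measurable N -> M `<=` N ->
  E M x = x -> E N x = x.
Proof. by move=> mM mN MN <-; exact: pvm_sub. Qed.

Lemma pvm_rangeI M N x : measurable M -> measurable N -> E N x = x ->
  E (M `&` N) (E M x) = E M x.
Proof.
move=> mM mN Nx; rewrite -projI//; last exact: measurableI.
by rewrite setIAC setIid projI// Nx.
Qed.

(** |x - E(F_n) x|^2 is the mass of the complement of F_n for <E(.)x, x>. *)
Lemma pvm_cvg (F : (set (measurableTypeR R))^nat) x :
  (forall n, measurable (F n)) -> nondecreasing_seq F -> \bigcup_n F n = setT ->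
  forall e : R, 0 < e -> exists k, forall n, (k <= n)%N -> nm (x - E (F n) x) < e.
Proof.
move=> mF ndF FT e e0.
have mFU : measurable (\bigcup_n F n) by rewrite FT.
have := @nondecreasing_cvg_mu _ _ _ (spectral_dist E x) F mF mFU ndF.
rewrite FT => /fine_cvg; rewrite -/(spectral_dist E x setT) => h.
have e2 : 0 < e ^+ 2 by rewrite exprn_gt0.
move/cvgrPdist_lt : h => /(_ _ e2)[k _ NP]; exists k => n Nn.
rewrite -(@ltr_pXn2r _ 2) ?nnegrE ?nm_ge0 ?(ltW e0)//.
have {}NP : `|rd (E setT x) x - rd (E (F n) x) x| < e ^+ 2 by exact: NP.
apply: le_lt_trans NP; rewrite projT -nm_sqr pvm_rdot.
rewrite nmB_sqr rdotC pvm_rdot; apply: le_trans (ler_norm _).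
by lra.
Qed.

End Pvm.

(** * Polar factorization through the functional calculus *)

Section SpectralRepresentation.
Context {R : realType} {H : completeNormedModType R[i]}.
Context {dot : {dot H for Num.conj}} (Hdot : induces_norm dot).
Local Notation rd := (rdot dot).
Local Notation nm := (nm dot).
Context {E : pvm dot} {B C N : operator H}.
Hypothesis Bsa : selfadjoint dot B.
Hypothesis BE : spectral_measure_of B E.
Hypothesis CE : spectral_integral E (fun l => Num.sqrt `|l|) C.
Hypothesis NE : spectral_integral E Num.sg N.
Hypothesis Cdense : forall x (e : R), 0 < e -> exists2 y, dom C y & nm (x - y) < e.
Implicit Types (x y z : H) (M : set (measurableTypeR R)).

Let mB : measurable_fun [set: measurableTypeR R] (id : measurableTypeR R -> R).
Proof. exact: measurable_id. Qed.

Let mC : measurable_fun [set: measurableTypeR R]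
  ((fun l => Num.sqrt `|l|) : measurableTypeR R -> R).
Proof.
apply: (measurableT_comp (continuous_measurable_fun (@sqrt_continuous R))).
exact: normr_measurable.
Qed.

Let mN : measurable_fun [set: measurableTypeR R] (Num.sg : measurableTypeR R -> R).
Proof.
apply: nondecreasing_measurable => // x y xy.
case: (sgrP y) => [y0|y0|y0]; case: (sgrP x) => [x0|x0|x0] //; lra.
Qed.

Let Bdense x (e : R) : 0 < e -> exists2 y, dom B y & nm (x - y) < e.
Proof. exact: (sa_dense Hdot Bsa). Qed.

Lemma sign_dom x : dom N x.
Proof.
rewrite (si_dom NE); apply: le_lt_trans (_ : (\int[spectral_dist E x]_l 1 < +oo)%E).
  apply: ge0_le_integral => //.
  - by move=> l _; rewrite lee_fin sqr_ge0.
  - by apply/measurable_EFinP; exact: measurable_funX mN.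
  move=> l _; rewrite lee_fin.
  by case: (sgrP l) => _; rewrite ?expr0n ?sqrrN ?expr1n ?ler01.
by rewrite integral_cst// mul1e; exact: ltry.
Qed.

Let Ndense x (e : R) : 0 < e -> exists2 y, dom N y & nm (x - y) < e.
Proof. by move=> e0; exists x; [exact: sign_dom|rewrite subrr nm0]. Qed.

Lemma sign_le x : nm (N x) <= nm x.
Proof.
have := @si_range_close _ _ _ _ _ _ NE mN Ndense setT 0 1 x measurableT _ (projT E x).
rewrite rmorph0 scale0r subr0 mul1r; apply => l _; rewrite subr0 normr_sg.
by case: (l != 0).
Qed.

Lemma abs_sqrt_dom x : dom B x -> dom C x.
Proof.
rewrite (si_dom BE) (si_dom CE) => h.
apply: le_lt_trans (_ : (\int[spectral_dist E x]_l (1 + (l ^+ 2)%:E) < +oo)%E).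
  apply: ge0_le_integral => //.
  - by apply/measurable_EFinP; exact: measurable_funX mC.
  - by apply: emeasurable_funD => //; apply/measurable_EFinP; exact: measurable_funX mB.
  move=> l _; rewrite -EFinD lee_fin sqr_sqrtr ?normr_ge0//.
  rewrite ler_norml; have := sqr_ge0 (l - 1); have := sqr_ge0 (l + 1).
  by have := sqr_ge0 l; move=> ? ? ?; apply/andP; split; nra.
rewrite ge0_integralD//; last 2 first.
- by move=> l _; rewrite lee_fin sqr_ge0.
- by apply/measurable_EFinP; exact: measurable_funX mB.
by rewrite integral_cst// mul1e; apply: lte_add_pinfty => //; exact: ltry.
Qed.

(** Here s is 1 or -1: the points of the half-line of sign s, the origin included,
at distance less than r from the origin. *)
Definition side (s r : R) : set (measurableTypeR R) := [set l | 0 <= s * l < r].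

Definition cell (s a b : R) : set (measurableTypeR R) := [set l | a <= s * l < b].

Let mcell s a b : measurable (cell s a b).
Proof.
have := @mulrl_measurable R setT s measurableT _ (measurable_itv `[a, b[).
by rewrite setTI; congr (measurable _); apply/seteqP; split=> l /=; rewrite in_itv.
Qed.

Let mside s r : measurable (side s r). Proof. exact: mcell. Qed.

Let abs_side (s l : R) : s ^+ 2 = 1 -> 0 <= s * l -> `|l| = s * l.
Proof.
move=> s1 sl; rewrite -(ger0_norm sl) normrM.
suff -> : `|s| = 1 by rewrite mul1r.
by apply/eqP; rewrite -(@eqrXn2 _ 2)// real_normK ?num_real// s1 expr1n.
Qed.

(** On the cell, |l| = s l lies between a and b, so both s <Bz, z> and | |B|^{1/2} z |^2
lie between a |z|^2 and b |z|^2. *)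
Lemma cell_estimate (s a b : R) z : s ^+ 2 = 1 -> 0 <= a -> a <= b ->
  E (cell s a b) z = z ->
  `|s * rd (B z) z - nm (C z) ^+ 2| <= (b - a) * nm z ^+ 2.
Proof.
move=> s1 a0 ab Mz; have mM := mcell s a b.
have b0 := le_trans a0 ab.
have z2 := sqr_ge0 (nm z).
have [Bl Bu] : a * nm z ^+ 2 <= s * rd (B z) z /\ s * rd (B z) z <= b * nm z ^+ 2.
  have [s0|s0] := lerP 0 s.
    have {s1 s0}s1 : s = 1 by nra.
    subst s; have [|_ h1 h2] := @si_bounds _ _ _ _ _ _ BE mB _ a b z mM _ Mz.
      by move=> l /andP[]; rewrite mul1r => -> /ltW ->.
    by rewrite mul1r.
  have {s1 s0}s1 : s = -1 by nra.
  subst s; have [|_ h1 h2] := @si_bounds _ _ _ _ _ _ BE mB _ (- b) (- a) z mM _ Mz.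
    by move=> l /andP[h1 h2]; apply/andP; split; lra.
  by split; lra.
have sq l : cell s a b l -> Num.sqrt a <= Num.sqrt `|l| <= Num.sqrt b.
  move=> /andP[h1 h2]; rewrite (abs_side s1); last exact: le_trans h1.
  by rewrite !ler_wsqrtr// ltW.
have [Cz h1 h2] := si_bounds CE mC mM sq Mz.
have h3 : nm (C z) <= Num.sqrt b * nm z.
  have := @si_range_close _ _ _ _ _ _ CE mC Cdense _ 0 (Num.sqrt b) z mM _ Mz.
  rewrite rmorph0 scale0r subr0; apply => l /sq/andP[_].
  by rewrite subr0 (ger0_norm (sqrtr_ge0 _)).
have h4 : Num.sqrt a * nm z <= nm (C z).
  have [z0|z0] := eqVneq (nm z) 0; first by rewrite z0 mulr0 nm_ge0.
  have pz : 0 < nm z by rewrite lt_def z0 nm_ge0.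
  rewrite -(ler_pM2r pz) -mulrA -expr2; apply: le_trans h1 _; exact: rdot_le.
have h5 : nm (C z) ^+ 2 <= b * nm z ^+ 2.
  rewrite -{1}(sqr_sqrtr b0) -exprMn ler_pXn2r ?nnegrE ?nm_ge0//.
  by rewrite mulr_ge0 ?sqrtr_ge0 ?nm_ge0.
have h6 : a * nm z ^+ 2 <= nm (C z) ^+ 2.
  rewrite -{1}(sqr_sqrtr a0) -exprMn ler_pXn2r ?nnegrE ?nm_ge0//.
  by rewrite mulr_ge0 ?sqrtr_ge0 ?nm_ge0.
by rewrite ler_norml; apply/andP; split; lra.
Qed.

Let BL := si_linear BE.
Let CL := si_linear CE.
Let NL := si_linear NE.

Lemma bounded_range_dom (r : R) M z : measurable M ->
  (forall l, M l -> `|l| <= r) -> E M z = z -> dom B z.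
Proof.
move=> mM Mr Mz; have [|//] := @si_bounds _ _ _ _ _ _ BE mB M (- r) r z mM _ Mz.
by move=> l /Mr; rewrite ler_norml.
Qed.

Lemma side_bounded (s r : R) l : s ^+ 2 = 1 -> side s r l -> `|l| <= r.
Proof. by move=> s1 /andP[h1 h2]; rewrite (abs_side s1)// ltW. Qed.

(** Cut the interval into k cells of length d.  Since B and |B|^{1/2} commute with
the spectral projections, all three terms are additive over the cells. *)
Lemma side_estimate (s d : R) k z : s ^+ 2 = 1 -> 0 <= d ->
  E (side s (k%:R * d)) z = z ->
  `|s * rd (B z) z - nm (C z) ^+ 2| <= d * nm z ^+ 2.
Proof.
move=> s1 d0; elim: k z => [|k IH] z zE.
  have -> : z = 0.
    rewrite -zE (_ : side _ _ = set0) ?proj0//.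
    by apply/seteqP; split=> // l /andP[]; lra.
  by rewrite (op0 BL) (op0 CL) rdot0l nm0 expr0n mulr0 subr0 normr0 mulr0.
pose a := k%:R * d; pose b := k.+1%:R * d.
have a0 : 0 <= a by rewrite mulr_ge0.
have bE : b = a + d by rewrite /b /a -natr1; ring.
have YW : side s b = side s a `|` cell s a b.
  apply/seteqP; split=> l; rewrite /side /cell /=.
    move=> /andP[h1 h2]; have [h|h] := ltP (s * l) a; [left|right].
      by rewrite h1.
    by rewrite h2.
  by move=> [] /andP[h1 h2]; apply/andP; split; lra.
have disj : side s a `&` cell s a b = set0.
  apply/seteqP; split=> // l [/andP[_ h1] /andP[h2 _]].
  by move: (le_lt_trans h2 h1); rewrite ltxx.
have mY := mside s a; have mW := mcell s a b.
pose p := E (side s a) z; pose q := E (cell s a b) z.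
have zpq : z = p + q by rewrite -zE -/b YW pvmU.
have Yp : E (side s a) p = p by exact: proj_idem.
have Wq : E (cell s a b) q = q by exact: proj_idem.
have subW l : cell s a b l -> `|l| <= b.
  move=> /andP[h1 h2]; rewrite (abs_side s1); last by lra.
  exact: ltW.
have Bp : dom B p by apply: bounded_range_dom mY _ Yp => l; exact: side_bounded.
have Bq : dom B q by exact: bounded_range_dom mW subW Wq.
have Cp := abs_sqrt_dom Bp; have Cq := abs_sqrt_dom Bq.
have YBp := si_range BE mB Bdense mY Bp Yp; have YCp := si_range CE mC Cdense mY Cp Yp.
have WBq := si_range BE mB Bdense mW Bq Wq; have WCq := si_range CE mC Cdense mW Cq Wq.
have orth u w := @pvm_range_orth _ _ _ E _ _ u w mY mW disj.
have h1 := IH p Yp.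
have h2 : `|s * rd (B q) q - nm (C q) ^+ 2| <= d * nm q ^+ 2.
  have -> : d = b - a by rewrite bE; ring.
  by apply: cell_estimate; rewrite // bE lerDl.
have -> : rd (B z) z = rd (B p) p + rd (B q) q.
  rewrite zpq opD// rdotDl !rdotDr (orth (B p) q)// (rdotC _ (B q) p) (orth p (B q))//.
  by ring.
have -> : nm (C z) ^+ 2 = nm (C p) ^+ 2 + nm (C q) ^+ 2.
  by rewrite zpq opD// nmD_sqr orth//; ring.
have -> : nm z ^+ 2 = nm p ^+ 2 + nm q ^+ 2.
  by rewrite zpq nmD_sqr orth//; ring.
have -> : s * (rd (B p) p + rd (B q) q) - (nm (C p) ^+ 2 + nm (C q) ^+ 2) =
  (s * rd (B p) p - nm (C p) ^+ 2) + (s * rd (B q) q - nm (C q) ^+ 2) by ring.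
by apply: le_trans (ler_normD _ _) _; rewrite mulrDr lerD.
Qed.

(** Let the number of cells tend to infinity in [side_estimate]. *)
Lemma side_form (s r : R) z : s ^+ 2 = 1 -> 0 < r -> E (side s r) z = z ->
  s * rd (B z) z = nm (C z) ^+ 2.
Proof.
move=> s1 r0 zE; apply/eqP; rewrite -subr_eq0 -normr_le0.
apply: (@le_eps0 _ _ (nm z ^+ 2)) => e e0.
pose k := (Num.truncn (r / e)).+1.
have k0 : 0 < k%:R :> R by rewrite ltr0n.
apply: le_trans (_ : r / k%:R * nm z ^+ 2 <= _).
  apply: (@side_estimate _ _ k); rewrite ?divr_ge0 ?ltW//.
  by rewrite mulrCA divff ?mulr1// gt_eqF.
apply: ler_wpM2r; first exact: sqr_ge0.
by rewrite ler_pdivrMr// mulrC -ler_pdivrMr// ltW// truncnS_gt.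
Qed.

(** The component of z in the range of E({0}) is killed by |B|^{1/2}; on the range of
the rest of the half-line sign(B) is the multiplication by s. *)
Lemma sign_side (s r : R) z : s ^+ 2 = 1 -> E (side s r) z = z ->
  N (C z) = s%:C%C *: C z.
Proof.
move=> s1 zE; have m0 : measurable [set (0 : measurableTypeR R)] by exact: measurable_set1.
have mc := measurableC m0; have mS := mside s r.
pose z0 := E [set 0] z; pose z1 := E (~` [set 0]) z.
have E0 : E [set 0] z0 = z0 by exact: proj_idem.
have E1 : E (~` [set 0] `&` side s r) z1 = z1 by exact: pvm_rangeI.
have mI := measurableI _ _ mc mS.
have B0 : dom B z0.
  by apply: (bounded_range_dom m0 _ E0 (r := 0)) => l /= ->; rewrite normr0.
have B1 : dom B z1.
  by apply: (bounded_range_dom mI _ E1 (r := r)) => l [_]; exact: side_bounded.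
have C0 : C z0 = 0.
  apply: (@nm_eq0 _ _ dot); apply/eqP; rewrite eq_le nm_ge0 andbT.
  have := @si_range_close _ _ _ _ _ _ CE mC Cdense _ 0 0 z0 m0 _ E0.
  rewrite rmorph0 scale0r subr0 mul0r; apply => l /= ->.
  by rewrite normr0 sqrtr0 subr0 normr0.
have -> : C z = C z1.
  have zz : z = z0 + z1 by rewrite [z0 + z1]pvmC.
  by rewrite {1}zz opD ?C0 ?add0r//; exact: abs_sqrt_dom.
have E1C := si_range CE mC Cdense mI (abs_sqrt_dom B1) E1.
apply/eqP; rewrite -subr_eq0; apply/eqP/(@nm_eq0 _ _ dot)/eqP.
rewrite eq_le nm_ge0 andbT -(mul0r (nm (C z1))).
apply: (si_range_close NE mN Ndense mI _ E1C) => l [/= l0 /andP[h1 _]].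
suff -> : Num.sg l = s by rewrite subrr normr0.
have [s0|s0] := lerP 0 s.
  have {s1 s0}s1 : s = 1 by nra.
  subst s; rewrite gtr0_sg//; rewrite mul1r in h1.
  by rewrite lt_def h1 andbT; apply/eqP.
have {s1 s0}s1 : s = -1 by nra.
subst s; rewrite ltr0_sg//; rewrite mulN1r oppr_ge0 in h1.
by rewrite lt_def h1 andbT eq_sym; apply/eqP.
Qed.

Definition ball0 (r : R) : set (measurableTypeR R) := [set l | `|l| < r].

Let mball0 r : measurable (ball0 r).
Proof.
have := @normr_measurable R setT measurableT _ (measurable_itv `]-oo, r[).
by rewrite setTI; congr (measurable _); apply/seteqP; split=> l /=; rewrite in_itv.
Qed.

(** Split z into its components on the two half-lines. *)
Lemma ball_quadratic (r : R) z : 0 < r -> E (ball0 r) z = z ->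
  rd (B z) z = rd (N (C z)) (C z).
Proof.
move=> r0 zE; have mP := mside 1 r; have mQ := measurableC mP; have mb := mball0 r.
have s1 : (1 : R) ^+ 2 = 1 by rewrite expr1n.
have sN1 : (-1 : R) ^+ 2 = 1 by rewrite sqrrN expr1n.
pose p := E (side 1 r) z; pose q := E (~` side 1 r) z.
have zpq : z = p + q by rewrite [p + q]pvmC.
have Pp : E (side 1 r) p = p by exact: proj_idem.
have Qq0 : E (~` side 1 r `&` ball0 r) q = q by exact: pvm_rangeI.
have Qq : E (~` side 1 r) q = q by exact: proj_idem.
have Sq : E (side (-1) r) q = q.
  apply: pvm_range_sub Qq0 => //; first exact: measurableI.
  move=> l [/= /negP]; rewrite /side/= mul1r mulN1r /ball0/= ltr_norml => h /andP[h1 h2].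
  by move: h; rewrite h2 andbT -ltNge => h; apply/andP; split; lra.
have Bp : dom B p by apply: bounded_range_dom mP _ Pp => l; exact: side_bounded.
have Bq : dom B q by apply: bounded_range_dom Sq => // l; exact: side_bounded.
have Cp := abs_sqrt_dom Bp; have Cq := abs_sqrt_dom Bq.
have disj : side 1 r `&` ~` side 1 r = set0 by exact: setICr.
have orth u w := @pvm_range_orth _ _ _ E _ _ u w mP mQ disj.
have PBp := si_range BE mB Bdense mP Bp Pp; have QBq := si_range BE mB Bdense mQ Bq Qq.
have PCp := si_range CE mC Cdense mP Cp Pp; have QCq := si_range CE mC Cdense mQ Cq Qq.
have -> : rd (B z) z = rd (B p) p + rd (B q) q.
  rewrite zpq opD// rdotDl !rdotDr (orth (B p) q)// (rdotC _ (B q) p) (orth p (B q))//.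
  by ring.
have Cz : C z = C p + C q by rewrite {1}zpq opD.
rewrite Cz (opD NL (sign_dom _) (sign_dom _)) (sign_side s1 Pp) (sign_side sN1 Sq).
rewrite rdotDl !rdotDr !rdotZl (orth (C p) (C q))// (rdotC _ (C q) (C p)) (orth (C p) (C q))//.
rewrite -!nm_sqr -(side_form s1 r0 Pp) -(side_form sN1 r0 Sq); ring.
Qed.

Lemma ball_form (r : R) z w : 0 < r -> E (ball0 r) z = z -> E (ball0 r) w = w ->
  rd (B z) w = rd (N (C z)) (C w).
Proof.
move=> r0 zE wE; have mb := mball0 r.
have zwE : E (ball0 r) (z + w) = z + w by rewrite pvmD zE wE.
have bb l : ball0 r l -> `|l| <= r by exact: ltW.
have Bz := bounded_range_dom mb bb zE; have Bw := bounded_range_dom mb bb wE.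
have Cz := abs_sqrt_dom Bz; have Cw := abs_sqrt_dom Bw.
have := ball_quadratic r0 zwE; have := ball_quadratic r0 zE; have := ball_quadratic r0 wE.
rewrite (opD BL Bz Bw) (opD CL Cz Cw) (opD NL (sign_dom _) (sign_dom _)).
rewrite !rdotDl !rdotDr.
rewrite (sa_rsym Bsa Bw Bz) (rdotC _ w) (si_rsym NE (sign_dom (C w)) (sign_dom (C z))).
by rewrite (rdotC _ (C w)); lra.
Qed.

(** Apply [ball_form] to E(F_n) x and E(F_n) y, where F_n is the interval of radius
n + 1, move the projections to the left factors, and let n tend to infinity. *)
Lemma spectral_form x y : dom C x -> dom B y ->
  dot x (B y) = dot (C x) (N (C y)).
Proof.
move=> Cx By; have Cy := abs_sqrt_dom By.
pose F n := ball0 n.+1%:R.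
have mF n : measurable (F n) by exact: mball0.
have ndF : nondecreasing_seq F.
  move=> m n mn; apply/subsetPset => l /= h; apply: lt_le_trans h _.
  by rewrite ler_nat ltnS.
have FT : \bigcup_n F n = setT.
  apply/seteqP; split=> // l _; exists (Num.truncn `|l|) => //=.
  exact: truncnS_gt.
have real u : dom C u -> rd u (B y) = rd (C u) (N (C y)).
  move=> Cu; apply/eqP; rewrite -subr_eq0 -normr_le0.
  apply: (@le_eps0 _ _ (nm (B y) + nm (N (C y)))) => e e0.
  have [k kP] := @pvm_cvg _ _ _ E _ u mF ndF FT e e0.
  have [k' k'P] := @pvm_cvg _ _ _ E _ (C u) mF ndF FT e e0.
  pose n := maxn k k'.
  have h1 := kP n (leq_maxl _ _); have h2 := k'P n (leq_maxr _ _).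
  have [BEy BEyE] := si_commute BE mB Bdense (mF n) By.
  have [CEy CEyE] := si_commute CE mC Cdense (mF n) Cy.
  have [CEu CEuE] := si_commute CE mC Cdense (mF n) Cu.
  have [_ NEyE] := si_commute NE mN Ndense (mF n) (sign_dom (C y)).
  have key : rd (E (F n) u) (B y) = rd (E (F n) (C u)) (N (C y)).
    have n0 : 0 < n.+1%:R :> R by rewrite ltr0n.
    have := ball_form n0 (proj_idem E (F n) y) (proj_idem E (F n) u).
    rewrite BEyE CEyE CEuE NEyE [in LHS]pvm_rsym proj_idem [in RHS]pvm_rsym proj_idem.
    by rewrite (rdotC _ (B y)) (rdotC _ (N (C y))).
  have -> : rd u (B y) - rd (C u) (N (C y)) =
      rd (u - E (F n) u) (B y) - rd (C u - E (F n) (C u)) (N (C y)).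
    by rewrite !rdotBl key; ring.
  apply: le_trans (ler_normB _ _) _; rewrite mulrDr; apply: lerD.
    apply: le_trans (rdot_norm_le _ _ _) _; apply: ler_wpM2r; [exact: nm_ge0|exact: ltW].
  apply: le_trans (rdot_norm_le _ _ _) _; apply: ler_wpM2r; [exact: nm_ge0|exact: ltW].
have Cix : dom C ((- 'i%C) *: x) by apply: subspaceZ => //; exact: op_subspace CL.
rewrite !dot_rdot real//; congr Complex.
have ri u w : rd u ('i%C *: w) = rd ((- 'i%C) *: u) w.
  by rewrite /rdot dotZl dotZr; case: (dot u w) => a b /=; ring.
by rewrite !ri real// opZ.
Qed.

End SpectralRepresentation.

(** * The two components of an involution *)

Section OffDiagonal.
Context {R : realType} {H : completeNormedModType R[i]}.
Context {dot : {dot H for Num.conj}} (Hdot : induces_norm dot).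
Local Notation rd := (rdot dot).
Local Notation nm := (nm dot).
Implicit Types (x y z : H) (s t : R) (c : R[i]) (K : set H) (S T : operator H).
Context {J : {linear H -> H}} (JP : selfadjoint_involution dot J).

Lemma involD x y : J (x + y) = J x + J y. Proof. exact: raddfD. Qed.

Lemma involB x y : J (x - y) = J x - J y. Proof. exact: raddfB. Qed.

Lemma involZ c x : J (c *: x) = c *: J x. Proof. exact: linearZ. Qed.

(** For s = 1 and s = -1 these are the two subspaces induced by J; treating both
signs at once halves the arguments. *)
Definition eigen (s : R) : set H := [set x | J x = s%:C%C *: x].

Lemma ran_plusE : ran_plus J = eigen 1.
Proof.
apply/seteqP; split=> [_ [x _ <-]|x Jx].
  by rewrite /eigen/= involD (involK JP) rmorph1 scale1r addrC.
exists (2^-1%:C%C *: x) => //; rewrite involZ Jx rmorph1 scale1r -scalerDl.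
by rewrite -rmorphD (_ : 2^-1 + 2^-1 = 1 :> R) ?rmorph1 ?scale1r//; lra.
Qed.

Lemma ran_minusE : ran_minus J = eigen (-1).
Proof.
apply/seteqP; split=> [_ [x _ <-]|x Jx].
  by rewrite /eigen/= involB (involK JP) rmorphN rmorph1 scaleN1r opprB.
exists (2^-1%:C%C *: x) => //.
rewrite involZ Jx rmorphN rmorph1 scaleN1r scalerN opprK -scalerDl.
by rewrite -rmorphD (_ : 2^-1 + 2^-1 = 1 :> R) ?rmorph1 ?scale1r//; lra.
Qed.

Lemma eigen_subspace s : linear_subspace (eigen s).
Proof.
split; first by rewrite /eigen/= raddf0 scaler0.
move=> c x y; rewrite /eigen/= => Jx Jy; rewrite involD involZ Jx Jy.
by rewrite scalerDr !scalerA mulrC.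
Qed.

Lemma eigen_closed s : nm_closed dot (eigen s).
Proof.
move=> x xP; rewrite /eigen/=; apply/eqP; rewrite -subr_eq0; apply/eqP/(@nm_eq0 _ _ dot)/eqP.
rewrite eq_le nm_ge0 andbT; apply: (@le_eps0 _ _ (1 + `|s|)) => e /xP[y Jy xy].
have -> : J x - s%:C%C *: x = J (x - y) - s%:C%C *: (x - y).
  by rewrite involB Jy scalerBr opprB addrA subrK.
apply: le_trans (nmD _ _ _) _; rewrite nmN (invol_nm JP) nmZ.
by have := nm_ge0 dot (x - y); have := normr_ge0 s; nra.
Qed.

(** For s = 1 and s = -1, the orthogonal projection onto [eigen s]. *)
Definition part (s : R) x : H := 2^-1%:C%C *: (x + s%:C%C *: J x).

Lemma partB s x y : part s (x - y) = part s x - part s y.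
Proof. by rewrite /part involB -[RHS]scalerBr opprD addrACA -scalerBr. Qed.

Lemma part_eigen s x : s ^+ 2 = 1 -> eigen s (part s x).
Proof.
move=> s1; rewrite /eigen/part/= involZ involD involZ (involK JP).
rewrite scalerA mulrC -scalerA; congr (_ *: _).
by rewrite scalerDr scalerA -rmorphM -expr2 s1 rmorph1 scale1r addrC.
Qed.

Lemma part_id s x : s ^+ 2 = 1 -> eigen s x -> part s x = x.
Proof.
move=> s1 Jx; rewrite /part Jx scalerA -rmorphM -expr2 s1 rmorph1 scale1r.
by rewrite scalerDr -scalerDl -rmorphD (_ : 2^-1 + 2^-1 = 1 :> R) ?rmorph1 ?scale1r//; lra.
Qed.

Lemma part_sum x : x = part 1 x + part (-1) x.
Proof.
rewrite /part -scalerDr rmorphN rmorph1 scale1r scaleN1r addrACA subrr addr0.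
by rewrite scalerDr -scalerDl -rmorphD (_ : 2^-1 + 2^-1 = 1 :> R) ?rmorph1 ?scale1r//; lra.
Qed.

Lemma part_nm s x : s ^+ 2 = 1 -> nm (part s x) <= nm x.
Proof.
move=> s1; rewrite /part nmZ ger0_norm//.
have := nmD dot x (s%:C%C *: J x); rewrite nmZ (invol_nm JP).
suff -> : `|s| = 1 by lra.
by apply/eqP; rewrite -(@eqrXn2 _ 2)// real_normK ?num_real// s1 expr1n.
Qed.

Lemma part_dom s x T : linear_op T -> commutes J T -> dom T x ->
  dom T (part s x) /\ T (part s x) = part s (T x).
Proof.
move=> TL JT Tx; have TS := op_subspace TL; have [TJ TJE] := JT x Tx.
have TsJ : dom T (s%:C%C *: J x) by exact: subspaceZ.
have Txs : dom T (x + s%:C%C *: J x) by exact: subspaceD.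
by split; [exact: subspaceZ|rewrite /part opZ// opD// opZ// TJE].
Qed.

Section ReducedSquareRoot.
Context {A S : operator H}.
Hypotheses (Asa : selfadjoint dot A) (A0 : nonneg_op dot A) (JA : commutes J A).
Hypotheses (AS : is_sqrt dot A S) (JS : commutes J S).

Let clT : nm_closed dot [set: H]. Proof. by []. Qed.
Let AL := sa_linear Asa.

(** The quadratic forms of the reduced operator and of A agree on the domain of the
former, which is a core of Ss.  So Dom(Ss) is contained in Dom(S); conversely the
projection [part s] carries the core Dom(A) of S into the domain of the reduced
operator without increasing |S .|. *)
Lemma reduced_sqrt_dom s Ss : s ^+ 2 = 1 ->
  is_sqrt_in dot (eigen s) (op_restrict A (eigen s)) Ss ->
  dom Ss = dom S `&` eigen s.
Proof.
move=> s1 h; have [hSs _ _] := h; have [hS _ _] := AS.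
have SL := sa_linear hS; have SsL := sa_linear hSs.
have sub0 : linear_subspace [set: H] by [].
have AR := nonneg_resolvents Hdot sub0 clT Asa A0.
have core := sqrt_core Hdot AS AR.
have AS' := op_subspace AL.
have coreS : core_of dot (op_restrict A (eigen s)) Ss.
  apply: (sqrt_core Hdot h) => e e0 w Jw.
  have [x Ax xw] := AR e e0 w I.
  exists x => //=; split=> //.
  have [AJ AJE] := JA Ax.
  have Asx : dom A (s%:C%C *: x) by exact: subspaceZ.
  rewrite /eigen/=; apply/eqP; rewrite -subr_eq0; apply/eqP/(@nm_eq0 _ _ dot)/eqP.
  rewrite eq_le nm_ge0 andbT.
  apply: le_trans (sqrt_resolvent_contraction AS e0 (subspaceB AS' AJ Asx)) _.
  rewrite opB// opZ// -AJE scalerBr addrACA -opprD scalerA (mulrC _ s%:C%C) -scalerA -scalerDr.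
  have <- : J w = J x + e%:C%C *: J (A x) by rewrite -xw involD involZ.
  by rewrite xw Jw subrr nm0.
apply/seteqP; split=> [x Sx|x [Sx Jx]].
  split; last exact: (sa_sub hSs Sx).
  have Ks : linear_subspace (dom (op_restrict A (eigen s))).
    split; first by split; [exact: AS'.1|exact: (eigen_subspace s).1].
    move=> c u w [Au Ju] [Aw Jw]; split; first exact: AS'.2.
    exact: (eigen_subspace s).2.
  suff [] : dom S x /\ nm (S x) ^+ 2 <= 1 * nm (Ss x) ^+ 2 + 0 * nm x ^+ 2 by [].
  move: x Sx; apply: (form_domain_transfer Hdot (p := id) (k := 1) coreS SL
    (sa_closed clT hS) SsL Ks).
  - by move=> u Tu; exact: (sqrt_sub h).
  - by [].
  - by move=> u; rewrite mul1r.
  move=> u Au; split; first by apply: (sqrt_sub AS); case: Au.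
  by rewrite (sqrt_nm h Au) (sqrt_nm AS)//; [rewrite /=; lra|case: Au].
rewrite -(part_id s1 Jx).
suff [] : dom Ss (part s x) /\
    nm (Ss (part s x)) ^+ 2 <= 1 * nm (S x) ^+ 2 + 0 * nm x ^+ 2 by [].
move: x Sx {Jx}; apply: (form_domain_transfer Hdot (p := part s) (k := 1) core SsL
  (sa_closed (eigen_closed (s := s)) hSs) SL AS').
- by move=> u Au; exact: (sqrt_sub AS).
- exact: partB.
- by move=> u; rewrite mul1r; exact: part_nm.
move=> u Au; have [Ap ApE] := part_dom s AL JA Au.
have Kp : dom (op_restrict A (eigen s)) (part s u) by split=> //; exact: part_eigen.
split; first exact: (sqrt_sub h).
rewrite (sqrt_nm h Kp) /= -(sqrt_nm AS Ap).
have [_ ->] := part_dom s SL JS (sqrt_sub AS Au).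
by have := part_nm (S u) s1; have := nm_ge0 dot (part s (S u)); nra.
Qed.

End ReducedSquareRoot.
End OffDiagonal.

(** * Off-diagonal form perturbations *)

Section OffDiagonalPerturbation.
Context {R : realType} {H : completeNormedModType R[i]}.
Context {dot : {dot H for Num.conj}} (Hdot : induces_norm dot).
Local Notation rd := (rdot dot).
Local Notation nm := (nm dot).
Implicit Types (x y z : H) (s t : R) (c : R[i]) (K : set H) (T : operator H).
Context {A S S1 : operator H} {J : {linear H -> H}} {v : dform H} {beta : R}.
Hypotheses (Asa : selfadjoint dot A) (A0 : nonneg_op dot A).
Hypotheses (JP : selfadjoint_involution dot J) (JA : commutes J A).
Hypotheses (AS : is_sqrt dot A S) (AS1 : is_sqrt dot (op_addI A) S1).
Hypotheses (vsesq : sesquilinear_dform v) (vsym : symmetric_dform v).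
Hypothesis Dv : dom S `<=` fdom v.
Hypothesis vJ : forall x y, dom S x -> dom S y -> v (J x) y = - v x (J y).
Hypothesis vbeta : forall x, dom S x -> `|v x x| <= beta%:C%C * `|S1 x| ^+ 2.

Local Notation b := (perturbed (indefinite_form dot J S) v).

Let hS : selfadjoint dot S. Proof. by case: AS. Qed.
Let SL : linear_op S. Proof. exact: sa_linear hS. Qed.
Let SS : linear_subspace (dom S). Proof. exact: op_subspace SL. Qed.
Let hS1 : selfadjoint dot S1. Proof. by case: AS1. Qed.
Let AL : linear_op A. Proof. exact: sa_linear Asa. Qed.

Let subT : linear_subspace [set: H]. Proof. by []. Qed.
Let clT : nm_closed dot [set: H]. Proof. by []. Qed.

Let domS1 : dom S1 = dom S.
Proof. by have [] := sqrt_addI Hdot Asa A0 AS AS1. Qed.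

Let nmS1 x : dom S x -> nm (S1 x) ^+ 2 = nm (S x) ^+ 2 + nm x ^+ 2.
Proof. by have [_] := sqrt_addI Hdot Asa A0 AS AS1; apply. Qed.

Let S1_ge x : dom S1 x -> nm x <= nm (S1 x).
Proof.
rewrite domS1 => Sx; rewrite -(@ler_pXn2r _ 2) ?nnegrE ?nm_ge0// nmS1//.
by have := sqr_ge0 (nm (S x)); lra.
Qed.

Let JS x : dom S x -> dom S (J x) /\ S (J x) = J (S x).
Proof.
move=> Sx.
exact: (sqrt_commutes Hdot AS (nonneg_resolvents Hdot subT clT Asa A0) AL JP JA Sx).
Qed.

Let JSc : commutes J S.
Proof. by move=> x Sx; have [? ->] := JS Sx. Qed.

Let vl c x y z : dom S x -> dom S y -> dom S z ->
  v (c *: x + y) z = c * v x z + v y z.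
Proof. by case: vsesq => _ + _ => h *; apply: h; exact: Dv. Qed.

Let vr c x y z : dom S x -> dom S y -> dom S z ->
  v z (c *: x + y) = c^* * v z x + v z y.
Proof. by case: vsesq => _ _ h *; apply: h; exact: Dv. Qed.

Let vD x y z : dom S x -> dom S y -> dom S z -> v (x + y) z = v x z + v y z.
Proof. by move=> *; rewrite -[x in LHS]scale1r vl// mul1r. Qed.

Let vDr x y z : dom S x -> dom S y -> dom S z -> v z (x + y) = v z x + v z y.
Proof. by move=> *; rewrite -[x in LHS]scale1r vr// conjC1 mul1r. Qed.

Let v0l z : dom S z -> v 0 z = 0.
Proof.
move=> Sz; apply: (addrI (v 0 z)); rewrite -vD ?addr0//; exact: SS.1.
Qed.

Let v0r z : dom S z -> v z 0 = 0.
Proof.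
move=> Sz; apply: (addrI (v z 0)); rewrite -vDr ?addr0//; exact: SS.1.
Qed.

Let vZ c x z : dom S x -> dom S z -> v (c *: x) z = c * v x z.
Proof.
by move=> Sx Sz; rewrite -[c *: x]addr0 vl ?v0l ?addr0//; exact: SS.1.
Qed.

Let vZr c x z : dom S x -> dom S z -> v z (c *: x) = c^* * v z x.
Proof.
by move=> Sx Sz; rewrite -[c *: x]addr0 vr ?v0r ?addr0//; exact: SS.1.
Qed.

Let vC x y : dom S x -> dom S y -> v x y = (v y x)^*.
Proof. by move=> *; apply: vsym; exact: Dv. Qed.

(** Off-diagonality gives v[Jx, x] = - v[x, Jx], and symmetry makes this the
opposite of the conjugate of v[Jx, x]. *)
Let vJ_re x : dom S x -> complex.Re (v (J x) x) = 0.
Proof.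
move=> Sx; have := vJ Sx Sx; rewrite [v x _]vC//; last by case: (JS Sx).
by case: (v (J x) x) => p q [] /=; lra.
Qed.

Lemma off_diagonal s x y : s != 0 -> dom S x -> dom S y -> eigen (J := J) s x ->
  eigen (J := J) s y -> v x y = 0.
Proof.
move=> s0 Sx Sy Jx Jy; have := vJ Sx Sy; rewrite Jx Jy vZ// vZr//.
have -> : (s%:C%C)^* = s%:C%C :> R[i] by rewrite /=; congr Complex; rewrite oppr0.
move=> /eqP; rewrite -addr_eq0 -mulrDl mulf_eq0 -rmorphD => /orP[|/eqP//].
move/eqP => [] /eqP; rewrite -mulr2n mulrn_eq0/= => /eqP s00.
by rewrite s00 eqxx in s0.
Qed.

Let form_of (g : dform H) : Prop := [/\ fdom g = dom S,
  sesquilinear_dform g & symmetric_dform g].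

Let b_form : form_of b.
Proof.
split=> //.
  split=> //= [c x y z Sx Sy Sz|c x y z Sx Sy Sz].
    by rewrite SL.2// dotDl dotZl vl// mulrDr addrACA.
  by rewrite SL.2// involD involZ dotDr dotZr vr// mulrDr addrACA.
move=> x y /= Sx Sy; rewrite rmorphD /= -vC// dotC -(invol_sym JP); congr (_^* + _).
Qed.

(** Adding <., J.> to b adds |x|^2 to Re b[Jx, x]; the operator B is
recovered by subtracting the bounded operator J. *)
Definition shifted_form : dform H := Form (dom S) (fun x y => b x y + dot x (J y)).

Let shifted_formP : form_of shifted_form.
Proof.
case: b_form => _ [_ bl br] bC; split=> //.
  split=> //= [c x y z Sx Sy Sz|c x y z Sx Sy Sz].
    by have /= -> := bl c x y z Sx Sy Sz; rewrite dotDl dotZl [in RHS]mulrDr addrACA.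
  have /= -> := br c x y z Sx Sy Sz.
  by rewrite involD involZ dotDr dotZr [in RHS]mulrDr addrACA.
move=> x y /= Sx Sy; have /= -> := bC x y Sx Sy; rewrite [in RHS]rmorphD /=.
by congr (_ + _); rewrite -(invol_sym JP) dotC.
Qed.

Let v_bound x : dom S x -> `|complex.Re (v x x)| <= beta * nm (S1 x) ^+ 2.
Proof.
move=> Sx; have := vbeta Sx.
rewrite (norm_nm Hdot) -rmorphXn -rmorphM => h.
by rewrite -lecR; apply: le_trans h; exact: normc_ge_Re.
Qed.

Let b_bound x : dom S x -> `|complex.Re (b x x)| <= (1 + beta) * nm (S1 x) ^+ 2.
Proof.
move=> Sx; rewrite /= raddfD; apply: le_trans (ler_normD _ _) _.
rewrite mulrDl mul1r; apply: lerD; last exact: v_bound.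
apply: le_trans (rdot_norm_le _ _ _) _; rewrite (invol_nm JP) nmS1//.
by have := sqr_ge0 (nm x); rewrite expr2; lra.
Qed.

Let shifted_coercive : twisted_coercive dot S1 shifted_form J (2 + beta).
Proof.
split=> x /= Sx; have [SJ SJE] := JS Sx.
- rewrite raddfD; apply: le_trans (ler_normD _ _) _.
  have -> : 2 + beta = (1 + beta) + 1 by ring.
  rewrite mulrDl mul1r; apply: lerD; first exact: b_bound.
  apply: le_trans (rdot_norm_le _ _ _) _; rewrite (invol_nm JP) nmS1//.
  by have := sqr_ge0 (nm (S x)); rewrite -expr2; lra.
- rewrite domS1; split=> //; rewrite -(@ler_pXn2r _ 2) ?nnegrE ?nm_ge0//.
  by rewrite !nmS1// SJE !(invol_nm JP).
rewrite !raddfD /= vJ_re// addr0 nmS1// SJE.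
by rewrite -!/(rdot dot _ _) -!nm_sqr !(invol_nm JP).
Qed.

Let shifted_solve :
  (forall h, exists2 y, dom S1 y &
     forall x, dom S1 x -> shifted_form x y = dot x h) /\
  (forall y (e : R), dom S1 y -> 0 < e ->
     exists z h, [/\ dom S1 z, forall x, dom S1 x -> shifted_form x z = dot x h &
                     nm (S1 (y - z)) < e]).
Proof.
have [_ fs fC] := shifted_formP.
exact: (@lax_milgram _ _ _ Hdot S1 shifted_form J (2 + beta) hS1 S1_ge (esym domS1)
  fs fC shifted_coercive).
Qed.

(** Density of Dom(B) in D for the norm |(A+I)^{1/2} .|. *)
Let b_core y (e : R) : dom S y -> 0 < e ->
  exists z h, form_graph dot b z h /\ nm (S1 (y - z)) < e.
Proof.
move=> Sy e0; have [_ /(_ y e)] := shifted_solve; rewrite domS1.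
move=> /(_ Sy e0)[z [h [Sz zh yz]]]; exists z, (h - J z); split=> //.
by split=> // x Sx; rewrite dotBr -zh// addrK.
Qed.

Lemma form_operator : exists B : operator H,
  [/\ selfadjoint dot B, associated dot b B,
      forall B' : operator H,
        selfadjoint dot B' -> associated dot b B' -> graph B' = graph B &
      forall y h, form_graph dot b y h <-> dom B y /\ B y = h].
Proof.
have [_ bs bC] := b_form.
apply: (associated_operator Hdot bs bC JP).
- by move=> x e; exact: (sa_dense Hdot hS).
- move=> y e Sy e0; have [z [h [zh yz]]] := b_core Sy e0; exists z, h; split=> //.
  have [Sz _] := zh; apply: le_lt_trans yz; apply: S1_ge; rewrite domS1.
  exact: subspaceB.
by move=> h; have [/(_ h)[y]] := shifted_solve; rewrite domS1 => Sy yh; exists y.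
Qed.

Section Operator.
Context {B : operator H}.
Hypothesis Bsa : selfadjoint dot B.
Hypothesis BP : forall y h, form_graph dot b y h <-> dom B y /\ B y = h.

Let Bb y : dom B y -> dom S y.
Proof. by move=> By; have [] := (BP y (B y)).2 (conj By erefl). Qed.

Let BE x y : dom S x -> dom B y -> b x y = dot x (B y).
Proof. by move=> Sx By; have [_] := (BP y (B y)).2 (conj By erefl); apply. Qed.

(** Both sides are continuous in y for the norm |S1 .|, the right one by
[symmetric_relatively_bounded], and they agree for y in Dom(B), which is dense
for this norm.  Real parts are compared first; the imaginary parts are the real
parts at i x. *)
Lemma form_represented (E : pvm dot) (C N : operator H) :
  spectral_measure_of B E ->
  spectral_integral E (fun l => Num.sqrt `|l|) C ->
  spectral_integral E Num.sg N ->
  dom C = dom S -> forall x y, dom S x -> dom S y -> b x y = dot (C x) (N (C y)).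
Proof.
move=> EB EC EN CS.
have CL := si_linear EC; have NL := si_linear EN.
have Cdense x (e : R) : 0 < e -> exists2 y, dom C y & nm (x - y) < e.
  by rewrite CS; exact: (sa_dense Hdot hS).
have Cs x y := @si_rsym _ _ _ _ _ _ EC x y.
have [|K KP] := symmetric_relatively_bounded Hdot hS1 S1_ge CL Cs.
  by rewrite domS1 CS.
rewrite domS1 in KP.
have [_ bs bC] := b_form.
have bM : forall x, fdom b x -> `|complex.Re (b x x)| <= (1 + beta) * nm (S1 x) ^+ 2.
  by move=> x; exact: b_bound.
have bnd := @form_bound _ _ _ Hdot S1 b (1 + beta) hS1 S1_ge (esym domS1) bs bC bM.
have bD x y z : dom S x -> dom S y -> dom S z -> b x (y - z) = b x y - b x z.
  move=> Sx Sy Sz; have [_ _ br] := bs.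
  rewrite addrC -scaleN1r; have /= -> := br (-1) z y x Sz Sy Sx.
  by rewrite rmorphN rmorph1 mulN1r addrC.
have re x y : dom S x -> dom S y -> complex.Re (b x y) = rd (C x) (N (C y)).
  move=> Sx Sy; apply/eqP; rewrite -subr_eq0 -normr_le0.
  apply: (@le_eps0 _ _ (`|1 + beta| * nm (S1 x) + nm (C x) * `|K|)) => e e0.
  have [z [h [/BP[Bz _] yz]]] := b_core Sy e0; have Sz := Bb Bz.
  have Syz : dom S (y - z) by exact: subspaceB.
  have Sny : dom S (- (y - z)) by exact: subspaceN.
  have [Cx Cy Cz] : [/\ dom C x, dom C y & dom C z] by rewrite CS.
  have E0 : complex.Re (b x z) = rd (C x) (N (C z)).
    rewrite BE// /rdot; congr complex.Re.
    exact: (spectral_form Hdot Bsa EB EC EN Cdense).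
  have -> : complex.Re (b x y) - rd (C x) (N (C y)) =
      complex.Re (b x (y - z)) - rd (C x) (N (C (y - z))).
    rewrite bD// ReB E0 (opB CL)// (opB NL) ?rdotBr; first by lra.
      exact: (sign_dom EN).
    exact: (sign_dom EN).
  apply: le_trans (ler_normB _ _) _; rewrite mulrDr.
  have n1 := nm_ge0 dot (S1 x); have n2 := nm_ge0 dot (S1 (y - z)).
  apply: lerD.
    apply: le_trans (_ : `|1 + beta| * nm (S1 x) * nm (S1 (y - z)) <= _); last first.
      by rewrite mulrC; apply: ler_wpM2r; [rewrite mulr_ge0|exact: ltW].
    have up w : dom S w -> nm (S1 w) = nm (S1 (y - z)) ->
        complex.Re (b x w) <= `|1 + beta| * nm (S1 x) * nm (S1 (y - z)).
      move=> Sw <-; apply: le_trans (bnd x w Sx Sw) _.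
      apply: ler_wpM2r; first exact: nm_ge0.
      by apply: ler_wpM2r; [exact: nm_ge0|exact: ler_norm].
    rewrite ler_norml up// andbT.
    have := up _ Sny; rewrite (opN (sa_linear hS1)) ?domS1// nmN => /(_ erefl).
    have -> : b x (- (y - z)) = - b x (y - z).
      rewrite -[- (y - z)]add0r (bD x 0 (y - z) Sx SS.1 Syz).
      have -> : b x 0 = 0 by rewrite /= (op0 SL) raddf0 dot0r v0r// addr0.
      by rewrite sub0r.
    by rewrite ReN; lra.
  apply: le_trans (rdot_norm_le _ _ _) _; rewrite mulrCA.
  apply: ler_wpM2l; first exact: nm_ge0.
  apply: le_trans (sign_le EN _) _; apply: le_trans (KP _ Syz) _.
  apply: le_trans (_ : `|K| * nm (S1 (y - z)) <= _).
    by apply: ler_wpM2r => //; exact: ler_norm.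
  by rewrite mulrC; apply: ler_wpM2r => //; exact: ltW.
move=> x y Sx Sy.
have Six : dom S ('i%C *: x) by exact: subspaceZ.
have := re _ _ Sx Sy; have := re _ _ Six Sy.
have [_ bl _] := bs; have := bl 'i%C x 0 y Sx SS.1 Sy; rewrite addr0.
have -> : b 0 y = 0 by rewrite /= (op0 SL) dot0l v0l// addr0.
rewrite addr0 => -> ; rewrite opZ// ?CS// /rdot dotZl.
case: (b x y) => p q; case: (dot (C x) _) => p' q' /= h1 h2.
by congr Complex; lra.
Qed.

(** The identity Re b[Jx, x] = |Sx|^2 shows that a vector of Ker(B) is in Ker(A) and
annihilates v; conversely, for p and m as on the right-hand side, only the
mixed terms of v[y, p + m] survive, and they vanish by assumption. *)
Lemma form_kernel Sp Sm :
  is_sqrt_in dot (ran_plus J) (op_restrict A (ran_plus J)) Sp ->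
  is_sqrt_in dot (ran_minus J) (op_restrict A (ran_minus J)) Sm ->
  op_ker B =
  osum (op_ker (op_restrict A (ran_plus J)) `&`
          [set xp | dom Sp xp /\ forall xm, dom Sm xm -> v xp xm = 0])
       (op_ker (op_restrict A (ran_minus J)) `&`
          [set xm | dom Sm xm /\ forall xp, dom Sp xp -> v xp xm = 0]).
Proof.
rewrite (ran_plusE JP) (ran_minusE JP) => hp hm.
have s1 : (1 : R) ^+ 2 = 1 by rewrite expr1n.
have sN1 : (-1 : R) ^+ 2 = 1 by rewrite sqrrN expr1n.
have n1 : (1 : R) != 0 by exact: oner_neq0.
have nN1 : (-1 : R) != 0 by rewrite oppr_eq0.
have dp := reduced_sqrt_dom Hdot JP Asa A0 JA AS JSc s1 hp.
have dm := reduced_sqrt_dom Hdot JP Asa A0 JA AS JSc sN1 hm.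
have pS s x : dom S x -> dom S (part (J := J) s x).
  by move=> Sx; have [] := part_dom s SL JSc Sx.
apply/seteqP; split=> [x [Bx Bx0]|_ [p [[[Ap Jp] Ap0] [_ Lp]] [m [[[Am Jm] Am0] [_ Lm]] <-]]].
  have Sx := Bb Bx; have [SJ SJE] := JS Sx.
  have bx0 y : dom S y -> b y x = 0 by move=> Sy; rewrite BE// Bx0 dot0r.
  have Sx0 : S x = 0.
    apply: (@rdot_eq0 _ _ dot); have : complex.Re (b (J x) x) = 0 by rewrite (bx0 _ SJ).
    by rewrite /= raddfD /= vJ_re// addr0 SJE (invol_sym JP) (involK JP).
  have Ax : dom A x by apply/(sqrt_dom _ AS); rewrite Sx0; split=> //; exact: SS.1.
  have Ax0 : A x = 0 by rewrite (sqrtE AS Ax) Sx0 (op0 SL).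
  have vx0 y : dom S y -> v y x = 0.
    by move=> Sy; have := bx0 y Sy; rewrite /= Sx0 raddf0 dot0r add0r.
  have part_ker s : dom A (part (J := J) s x) /\ A (part (J := J) s x) = 0.
    have [Ap ->] := part_dom s AL JA Ax; split=> //.
    by rewrite Ax0 /part raddf0 scaler0 addr0 scaler0.
  have [Ap Ap0] := part_ker 1; have [Am Am0] := part_ker (-1).
  have Ep := part_eigen JP x s1; have Em := part_eigen JP x sN1.
  have xE := part_sum (J := J) x.
  exists (part (J := J) 1 x).
    split; first by split.
    split=> [|y]; first by rewrite dp; split=> //; exact: pS.
    rewrite dm => -[Sy Jy].
    have : v x y = 0 by rewrite vC// vx0// rmorph0.
    by rewrite {1}xE vD ?(off_diagonal nN1 _ Sy Em Jy) ?addr0//; exact: pS.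
  exists (part (J := J) (-1) x); last exact/esym.
  split; first by split.
  split=> [|y]; first by rewrite dm; split=> //; exact: pS.
  rewrite dp => -[Sy Jy].
  have := vx0 y Sy.
  by rewrite {1}xE vDr ?(off_diagonal n1 Sy _ Jy Ep) ?add0r//; exact: pS.
apply/BP.
have ker_S y : dom A y -> A y = 0 -> S y = 0.
  move=> Ay Ay0; apply: (@rdot_eq0 _ _ dot).
  by rewrite -nm_sqr (sqrt_nm AS Ay) Ay0 rdot0l.
have Sp' := sqrt_sub AS Ap; have Sm' := sqrt_sub AS Am.
split=> [|y Sy]; first exact: subspaceD.
rewrite dot0r /= opD// (ker_S p)// (ker_S m)// addr0 raddf0 dot0r add0r.
have Syp := pS 1 _ Sy; have Sym := pS (-1) _ Sy.
rewrite vDr// {1 2}(part_sum (J := J) y) !vD//.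
have Ep := part_eigen JP y s1; have Em := part_eigen JP y sN1.
rewrite (off_diagonal n1 Syp Sp' Ep Jp) (off_diagonal nN1 Sym Sm' Em Jm).
rewrite (vC Sym Sp') Lp ?dm; last by split.
by rewrite rmorph0 Lm ?dp; [rewrite !addr0|split].
Qed.

End Operator.
End OffDiagonalPerturbation.

Theorem theorem2 (R : realType) (H : completeNormedModType R[i])
    (dot : {dot H for Num.conj}) (Hdot : induces_norm dot)
    (A : operator H) (A_sa : selfadjoint dot A) (A_ge0 : nonneg_op dot A)
    (J : {linear H -> H}) (J_inv : selfadjoint_involution dot J)
    (JA : commutes J A)
    (sqrtA : operator H) (sqrtAP : is_sqrt dot A sqrtA)
    (sqrtA1 : operator H) (sqrtA1P : is_sqrt dot (op_addI A) sqrtA1)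
    (v : dform H) (v_sesq : sesquilinear_dform v) (v_sym : symmetric_dform v)
    (beta : R) :
  let a := indefinite_form dot J sqrtA in
  let b := perturbed a v in
  fdom a `<=` fdom v ->
  (forall x y, fdom a x -> fdom a y -> v (J x) y = - v x (J y)) ->
  (forall x, fdom a x -> `|v x x| <= beta%:C%C * `|sqrtA1 x| ^+ 2) ->
  exists B : operator H,
    [/\ selfadjoint dot B,
        associated dot b B,
        (forall B' : operator H,
           selfadjoint dot B' -> associated dot b B' -> graph B' = graph B),
        (* [absB12] is |B|^{1/2} and [sgnB] is sign(B) *)
        (forall (E : pvm dot) (absB12 sgnB : operator H),
           spectral_measure_of B E ->
           spectral_integral E (fun l => Num.sqrt `|l|) absB12 ->
           spectral_integral E Num.sg sgnB ->
           dom absB12 = fdom b ->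
           forall x y, fdom b x -> fdom b y ->
             b x y = dot (absB12 x) (sgnB (absB12 y))) &
        let Ap := op_restrict A (ran_plus J) in
        let Am := op_restrict A (ran_minus J) in
        forall sqrtAp sqrtAm : operator H,
          is_sqrt_in dot (ran_plus J) Ap sqrtAp ->
          is_sqrt_in dot (ran_minus J) Am sqrtAm ->
          let Lp := [set xp | dom sqrtAp xp /\
                       forall xm, dom sqrtAm xm -> v xp xm = 0] in
          let Lm := [set xm | dom sqrtAm xm /\
                       forall xp, dom sqrtAp xp -> v xp xm = 0] in
          op_ker B = osum (op_ker Ap `&` Lp) (op_ker Am `&` Lm)].
Proof.
move=> a b Dv vJ vbeta.
have [B [Bsa Bas Buniq BP]] := form_operator Hdot A_sa A_ge0 J_inv JA sqrtAP sqrtA1P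
  v_sesq v_sym Dv vJ vbeta.
exists B; split=> //.
  move=> E C N EB EC EN CS x y.
  exact: (form_represented Hdot A_sa A_ge0 J_inv JA sqrtAP sqrtA1P v_sesq v_sym
    Dv vJ vbeta Bsa BP EB EC EN CS).
move=> Ap Am Sp Sm hp hm /=.
exact: (form_kernel Hdot A_sa A_ge0 J_inv JA sqrtAP v_sesq v_sym Dv vJ BP hp hm).
Qed.
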